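(* Let $\Gamma$ be a groupoid and let $R=\bigoplus_{\gamma\in\Gamma}R_\gamma$ be a $\Gamma$-graded ring. The following statements are equivalent. (1) $R$ is a gr-semisimple ring. (2) There exist a set $J$, a family $(e_j)_{j\in J}\in(\Gamma_0)^J$ and, for each $j\in J$, a $\Gamma$-graded division ring $D_j$ with $\operatorname{supp}(D_j)\subseteq e_j\Gamma e_j$ and a $d$-finite sequence $\overline{\sigma}_j=(\sigma_{jk})_{k\in K_j}\in(e_j\Gamma)^{K_j}$ such that the family $\{\mathrm{M}_{K_j}(D_j)(\overline{\sigma}_j):j\in J\}$ is summable and $R\cong_{gr}\prod^{gr}_{j\in J}\mathrm{M}_{K_j}(D_j)(\overline{\sigma}_j)$. (3) There exist a set $J$ and, for each $j\in J$, a gr-prime $\Gamma$-graded division ring $D_j$ and a matricial sequence $\overline{\Sigma}_j=(\Sigma_{jk})_{k\in K_j}\in\mathcal{P}(\Gamma)^{K_j}$ for $D_j$ such that the family $\{\mathrm{M}_{K_j}(D_j)(\overline{\Sigma}_j):j\in J\}$ is summable and $R\cong_{gr}\prod^{gr}_{j\in J}\mathrm{M}_{K_j}(D_j)(\overline{\Sigma}_j)$. (4) There exists a summable family $\{R_j:j\in J\}$ of gr-simple $\Gamma_0$-artinian rings such that $R\cong_{gr}\prod^{gr}_{j\in J}R_j$.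
   Context: A groupoid $\Gamma$ is a small category with all morphisms invertible, identified with its set of morphisms; $\Gamma_0$ is its set of objects (identified with identity morphisms). For $\gamma:e\to f$ write $d(\gamma)=e$, $r(\gamma)=f$; $\delta\gamma$ is defined iff $d(\delta)=r(\gamma)$. $e\Gamma=\{\gamma:r(\gamma)=e\}$, $e\Gamma f=\{\gamma:r(\gamma)=e,d(\gamma)=f\}$. A $\Gamma$-graded ring is an associative ring $R=\bigoplus_{\gamma\in\Gamma}R_\gamma$ (additive subgroups) with $R_\gamma R_\delta\subseteq R_{\gamma\delta}$ if $\gamma\delta$ is defined and $R_\gamma R_\delta=0$ otherwise (generally, homogeneous components indexed by undefined products are $\{0\}$), always assumed object unital: for each $e\in\Gamma_0$, $R_e$ is a unital ring with identity $1_e$ (possibly $1_e=0$) and $1_{r(\gamma)}a=a=a1_{d(\gamma)}$ for $a\in R_\gamma$. $R$ need not be unital. $\operatorname{supp}(R)=\{\gamma:R_\gamma\neq0\}$, $\Gamma_0'(R)=\{e\in\Gamma_0:1_e\ne0\}$. $\cong_{gr}$ between rings means there is a degree-preserving ring isomorphism. Graded (right, two-sided) ideals are those that are sums of their intersections with the $R_\gamma$. A $\Gamma$-graded $R$-module is a right $R$-module $M=\bigoplus_\gamma M_\gamma$ with $M_\gamma R_\delta\subseteq M_{\gamma\delta}$ (zero if undefined) and $MR=M$; it is gr-simple if nonzero with only graded submodules $0$ and $M$, and gr-semisimple if it is a sum of gr-simple graded submodules. $R$ is gr-semisimple if $R_R$ is gr-semisimple (this is left-right symmetric). $R$ is gr-simple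 if $R\ne0$ and its only graded ideals are $0$ and $R$; gr-prime if $IJ\ne0$ for all nonzero graded ideals $I,J$. $R(e):=\bigoplus_{r(\gamma)=e}R_\gamma=1_eR$; $R$ is $\Gamma_0$-artinian if, for each $e\in\Gamma_0$, $R(e)$ satisfies the descending chain condition on graded right submodules (for gr-simple rings this is left-right symmetric). A $\Gamma$-graded division ring is a $\Gamma$-graded ring $D\neq0$ such that each nonzero $a\in D_\gamma$ has $a^{-1}\in D_{\gamma^{-1}}$ with $aa^{-1}=1_{r(\gamma)}$, $a^{-1}a=1_{d(\gamma)}$. For a family $\{R_j\}_{j\in J}$ of $\Gamma$-graded rings, $\prod^{gr}_{j}R_j$ is the $\Gamma$-graded ring with $\gamma$-component $\prod_j(R_j)_\gamma$. The family is summable if $\prod^{gr}_jR_j=\bigoplus_jR_j$; equivalently, for each $\gamma\in\Gamma$, $(R_j)_\gamma\ne0$ for only finitely many $j$. All index sets of matrix rings are non-empty. A sequence $(\sigma_i)_{i\in I}\in\Gamma^I$ is $d$-finite if for each $f\in\Gamma_0$ only finitely many $i$ satisfy $d(\sigma_i)=f$. A sequence $\overline{\Sigma}=(\Sigma_i)_{i\in I}$ of non-empty subsets of $\Gamma$ is matricial for $D$ if: for each $i$, for each $f\in\Gamma_0$ there is at most one $\sigma\in\Sigma_i$ with $d(\sigma)=f$, for each $f$ there is at most one $\sigma\in\Sigma_i$ with $r(\sigma)=f$, and $r(\sigma)\in\Gamma_0'(D)$ for all $\sigma\in\Sigma_i$; and for each $f\in\Gamma_0$ the set of $i$ such that some $\sigma\in\Sigma_i$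 has $d(\sigma)=f$ is finite. Then $\mathrm{M}_I(D)(\overline{\Sigma})$ is the $\Gamma$-graded ring $\bigoplus_\gamma\mathrm{M}_I(D)(\overline{\Sigma})_\gamma$ (with matrix multiplication), where $\mathrm{M}_I(D)(\overline{\Sigma})_\gamma$ is the set of $I\times I$ matrices over $D$ with finitely many nonzero entries whose $(i,j)$ entry lies in $D_{\Sigma_i\gamma\Sigma_j^{-1}}$; here $D_{\Sigma_i\gamma\Sigma_j^{-1}}:=D_{\sigma\gamma\tau^{-1}}$ if there are (unique) $\sigma\in\Sigma_i,\tau\in\Sigma_j$ with $d(\sigma)=r(\gamma)$, $d(\tau)=d(\gamma)$, and $\{0\}$ otherwise. A sequence $\overline{\sigma}=(\sigma_i)$ of elements is treated as the sequence of singletons $\{\sigma_i\}$. *)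

(* Defs.v *)
From HB Require Import structures.
From mathcomp Require Import all_boot all_order all_algebra.
From mathcomp Require Import all_classical.

Set Implicit Arguments.
Unset Strict Implicit.
Unset Printing Implicit Defensive.

Import GRing.Theory.
Local Open Scope classical_set_scope.
Local Open Scope ring_scope.

(* [gcomp x y] is the composite "x after y".  It is a total function, but it
   is meaningful only when [gdom x = grng y]; nothing is assumed about its
   other values. *)
Record groupoid := Groupoid {
  gobj : Type;
  gmor :> Type;
  gdom : gmor -> gobj;
  grng : gmor -> gobj;
  gid : gobj -> gmor;
  gcomp : gmor -> gmor -> gmor;
  ginv : gmor -> gmor;
  gdom_id : forall e, gdom (gid e) = e;
  grng_id : forall e, grng (gid e) = e;
  gdom_comp : forall x y, gdom x = grng y -> gdom (gcomp x y) = gdom y;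
  grng_comp : forall x y, gdom x = grng y -> grng (gcomp x y) = grng x;
  gcompA : forall x y z, gdom x = grng y -> gdom y = grng z ->
    gcomp x (gcomp y z) = gcomp (gcomp x y) z;
  gcomp1g : forall x, gcomp (gid (grng x)) x = x;
  gcompg1 : forall x, gcomp x (gid (gdom x)) = x;
  gdom_inv : forall x, gdom (ginv x) = grng x;
  grng_inv : forall x, grng (ginv x) = gdom x;
  gcompVg : forall x, gcomp (ginv x) x = gid (gdom x);
  gcompgV : forall x, gcomp x (ginv x) = gid (grng x)
}.

(* The paper's [e Gamma f]. *)
Definition ghom (G : groupoid) (e f : gobj G) : set G :=
  [set g | grng g = e /\ gdom g = f].

Definition additive_subgroup (V : zmodType) (S : set V) : Prop :=
  S 0 /\ forall x y, S x -> S y -> S (x - y).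

(* When [S] is a union of additive subgroups, this is their sum. *)
Definition fin_sums (V : zmodType) (S : set V) : set V :=
  [set x | exists s : seq V, (forall y, y \in s -> S y) /\ x = \sum_(y <- s) y].

Definition independent_family (G : Type) (V : zmodType) (C : G -> set V) :=
  forall n (g : 'I_n -> G) (x : 'I_n -> V), injective g ->
    (forall i, C (g i) (x i)) -> \sum_(i < n) x i = 0 -> forall i, x i = 0.

Definition homogeneous (G : Type) (V : zmodType) (C : G -> set V) : set V :=
  \bigcup_g C g.

(* [V] is the internal direct sum of the additive subgroups [C g]. *)
Definition is_grading (G : Type) (V : zmodType) (C : G -> set V) : Prop :=
  [/\ forall g, additive_subgroup (C g),
      fin_sums (homogeneous C) = [set: V]
    & independent_family C].

(* Object unital graded rings, not assumed to be unital. *)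
Record gring (G : groupoid) := GRingG {
  gring_sort :> zmodType;
  gmul : gring_sort -> gring_sort -> gring_sort;
  gpart : G -> set gring_sort;
  gone : gobj G -> gring_sort;
  gmulA : associative gmul;
  gmulDl : left_distributive gmul +%R;
  gmulDr : right_distributive gmul +%R;
  gpart_grading : is_grading gpart;
  gpart_mul : forall g h a b, gpart g a -> gpart h b -> gdom g = grng h ->
    gpart (gcomp g h) (gmul a b);
  gpart_mul0 : forall g h a b, gpart g a -> gpart h b -> gdom g <> grng h ->
    gmul a b = 0;
  gone_part : forall e, gpart (gid e) (gone e);
  gone_mul : forall g a, gpart g a -> gmul (gone (grng g)) a = a;
  gmul_one : forall g a, gpart g a -> gmul a (gone (gdom g)) = a
}.

Declare Scope gring_scope.
Delimit Scope gring_scope with gring.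
Local Open Scope gring_scope.
Notation "a ** b" := (gmul a b) (at level 40, left associativity) : gring_scope.

Definition supp (G : groupoid) (R : gring G) : set G :=
  [set g | exists2 a : R, gpart g a & a <> 0].

(* The paper's [Gamma_0'(R)]. *)
Definition obj_supp (G : groupoid) (R : gring G) : set (gobj G) :=
  [set e | gone R e <> 0].

Definition gr_iso (G : groupoid) (R S : gring G) : Prop :=
  exists f : R -> S,
    [/\ bijective f, {morph f : x y / x + y}, {morph f : x y / x ** y}
      & forall g a, gpart g a -> gpart g (f a)].

Record gmodule (G : groupoid) (R : gring G) := GModule {
  gmodule_sort :> zmodType;
  gact : gmodule_sort -> R -> gmodule_sort;
  mpart : G -> set gmodule_sort;
  gactA : forall m a b, gact m (a ** b) = gact (gact m a) b;
  gactDl : forall m m' a, gact (m + m') a = gact m a + gact m' a;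
  gactDr : forall m a b, gact m (a + b) = gact m a + gact m b;
  mpart_grading : is_grading mpart;
  mpart_act : forall g h m a, mpart g m -> gpart h a -> gdom g = grng h ->
    mpart (gcomp g h) (gact m a);
  mpart_act0 : forall g h m a, mpart g m -> gpart h a -> gdom g <> grng h ->
    gact m a = 0;
  gact_full : fin_sums [set x | exists m a, x = gact m a] =
              [set: gmodule_sort]
}.

(* The condition [N R = N] is not listed since it is automatic:
   a homogeneous [x] of degree [g] in [N] is equal to [x 1_(gdom g)]. *)
Definition gr_submodule (G : groupoid) (R : gring G) (M : gmodule R)
    (N : set M) : Prop :=
  [/\ additive_subgroup N, forall x a, N x -> N (gact x a)
    & N `<=` fin_sums (N `&` homogeneous (@mpart G R M))].

(* The graded submodules of the graded module [N] are the graded submodules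
   of [M] contained in [N]. *)
Definition gr_simple_submodule (G : groupoid) (R : gring G) (M : gmodule R)
    (N : set M) : Prop :=
  [/\ gr_submodule N, N <> [set 0]
    & forall N' : set M, gr_submodule N' -> N' `<=` N ->
        N' = [set 0] \/ N' = N].

Definition gr_semisimple_module (G : groupoid) (R : gring G) (M : gmodule R) :=
  fin_sums (\bigcup_(N in [set N : set M | gr_simple_submodule N]) N) = [set: M].

Section Regular.
Variables (G : groupoid) (R : gring G).

Lemma regular_full : fin_sums [set x | exists m a : R, x = m ** a] = [set: R].
Proof.
apply/seteqP; split=> // x _.
have [_ full _] := gpart_grading R.
have : fin_sums (homogeneous (@gpart _ R)) x by rewrite full.
move=> [s [hs ->]]; exists s; split=> // y /hs [g _ yg].
by exists y, (gone R (gdom g)); rewrite (gmul_one yg).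
Qed.

Definition regular : gmodule R :=
  @GModule G R R (@gmul G R) (@gpart G R) (@gmulA G R)
    (fun m m' a => gmulDl m m' a) (fun m a b => gmulDr m a b)
    (gpart_grading R) (@gpart_mul G R) (@gpart_mul0 G R) regular_full.

End Regular.

Definition gr_semisimple (G : groupoid) (R : gring G) : Prop :=
  gr_semisimple_module (regular R).

Definition gr_ideal (G : groupoid) (R : gring G) (I : set R) : Prop :=
  [/\ additive_subgroup I, forall x a, I x -> I (x ** a),
      forall x a, I x -> I (a ** x)
    & I `<=` fin_sums (I `&` homogeneous (@gpart G R))].

Definition ideal_mul (G : groupoid) (R : gring G) (I J : set R) : set R :=
  fin_sums [set x | exists a b, [/\ I a, J b & x = a ** b]].

Definition gr_simple (G : groupoid) (R : gring G) : Prop :=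
  [set: R] <> [set 0] /\
  forall I : set R, gr_ideal I -> I = [set 0] \/ I = [set: R].

Definition gr_prime (G : groupoid) (R : gring G) : Prop :=
  forall I J : set R, gr_ideal I -> gr_ideal J ->
    I <> [set 0] -> J <> [set 0] -> ideal_mul I J <> [set 0].

(* The paper's [R(e)], in the form [1_e R]. *)
Definition obj_part (G : groupoid) (R : gring G) (e : gobj G) : set R :=
  [set x | exists a, x = gone R e ** a].
Arguments obj_part {G} R e.

Definition obj_artinian (G : groupoid) (R : gring G) : Prop :=
  forall (e : gobj G) (N : nat -> set (regular R)),
    (forall n, gr_submodule (N n)) -> (forall n, N n `<=` obj_part R e) ->
    (forall n, N n.+1 `<=` N n) ->
    exists n, forall m, (n <= m)%N -> N m = N n.

Definition gr_division (G : groupoid) (D : gring G) : Prop :=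
  [set: D] <> [set 0] /\
  forall g (a : D), gpart g a -> a <> 0 ->
    exists b : D, [/\ gpart (ginv g) b, a ** b = gone D (grng g)
                    & b ** a = gone D (gdom g)].

(* A system of homogeneous components inside an ambient additive group whose
   multiplication needs to be well-behaved only on sums of homogeneous elements;
   [gring_of] is the graded ring formed by these sums. *)
Record hsystem (G : groupoid) := HSystem {
  hs_amb : zmodType;
  hs_mul : hs_amb -> hs_amb -> hs_amb;
  hs_part : G -> set hs_amb;
  hs_one : gobj G -> hs_amb;
  hs_sums := fin_sums (homogeneous hs_part);
  hs_sub : forall g, additive_subgroup (hs_part g);
  hs_indep : independent_family hs_part;
  hs_mulA : forall x y z, hs_sums x -> hs_sums y -> hs_sums z ->
    hs_mul x (hs_mul y z) = hs_mul (hs_mul x y) z;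
  hs_mulDl : forall x y z, hs_sums x -> hs_sums y -> hs_sums z ->
    hs_mul (x + y) z = hs_mul x z + hs_mul y z;
  hs_mulDr : forall x y z, hs_sums x -> hs_sums y -> hs_sums z ->
    hs_mul x (y + z) = hs_mul x y + hs_mul x z;
  hs_part_mul : forall g h a b, hs_part g a -> hs_part h b ->
    gdom g = grng h -> hs_part (gcomp g h) (hs_mul a b);
  hs_part_mul0 : forall g h a b, hs_part g a -> hs_part h b ->
    gdom g <> grng h -> hs_mul a b = 0;
  hs_one_part : forall e, hs_part (gid e) (hs_one e);
  hs_one_mul : forall g a, hs_part g a -> hs_mul (hs_one (grng g)) a = a;
  hs_mul_one : forall g a, hs_part g a -> hs_mul a (hs_one (gdom g)) = a
}.

Section FinSums.
Variable V : zmodType.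
Implicit Type S : set V.

Lemma fin_sums0 S : fin_sums S 0.
Proof. by exists [::]; rewrite big_nil. Qed.

Lemma fin_sumsD S x y : fin_sums S x -> fin_sums S y -> fin_sums S (x + y).
Proof.
move=> [s [hs ->]] [t [ht ->]]; exists (s ++ t); rewrite big_cat/=; split=> // z.
by rewrite mem_cat => /orP[/hs|/ht].
Qed.

Lemma fin_sumsN S x : (forall y, S y -> S (- y)) ->
  fin_sums S x -> fin_sums S (- x).
Proof.
move=> SN [s [hs ->]]; exists (map -%R s); split.
  by move=> y /mapP[z /hs Sz ->]; exact: SN.
by rewrite big_map sumrN.
Qed.

Lemma fin_sums1 S x : S x -> fin_sums S x.
Proof.
by exists [:: x]; rewrite big_seq1; split=> // y; rewrite inE => /eqP->.
Qed.

Lemma fin_sums_ind S (P : V -> Prop) :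
  P 0 -> (forall x y, S x -> fin_sums S y -> P y -> P (x + y)) ->
  forall x, fin_sums S x -> P x.
Proof.
move=> P0 PD x [s [hs ->]]; elim: s hs => [|a s IH] hs; first by rewrite big_nil.
rewrite big_cons; have hs' y : y \in s -> S y.
  by move=> ys; apply: hs; rewrite inE ys orbT.
apply: PD; [by apply: hs; rewrite mem_head|by exists s|exact: IH].
Qed.

Lemma additive_subgroupN S x : additive_subgroup S -> S x -> S (- x).
Proof. by move=> [S0 SB] Sx; rewrite -[- x]add0r; exact: SB. Qed.

Lemma additive_subgroupD S x y : additive_subgroup S -> S x -> S y -> S (x + y).
Proof.
move=> hS Sx Sy; rewrite -[y]opprK; have [_ SB] := hS; apply: SB => //.
exact: additive_subgroupN.
Qed.

End FinSums.

Lemma independent_cond (G : Type) (V : zmodType) (C : G -> set V) :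
  independent_family C ->
  forall n (P : pred 'I_n) (g : 'I_n -> G) (x : 'I_n -> V),
    {in P &, injective g} -> (forall i, P i -> C (g i) (x i)) ->
    \sum_(i < n | P i) x i = 0 -> forall i, P i -> x i = 0.
Proof.
move=> ind n P g x gI xC s0 i Pi.
have := ind #|P| (g \o enum_val) (x \o enum_val); rewrite /= => H.
have -> : x i = x (enum_val (enum_rank_in (Pi : i \in P) i)).
  by rewrite enum_rankK_in.
apply: H.
- move=> a b /= gab; apply: enum_val_inj; apply: gI gab; exact: enum_valP.
- by move=> a; apply: xC; exact: enum_valP.
- by rewrite -[RHS]s0 -(big_enum_val (A := P)).
Qed.

Section RingOf.
Variables (G : groupoid) (H : hsystem G).

Definition hs_pred : {pred hs_amb H} := fun x => `[< hs_sums x >].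

Lemma hs_predP x : reflect (hs_sums x) (x \in hs_pred).
Proof. exact: asboolP. Qed.

Lemma hs_homN x : homogeneous (@hs_part G H) x ->
  homogeneous (@hs_part G H) (- x).
Proof.
by move=> [g _ xg]; exists g => //; apply: additive_subgroupN xg; exact: hs_sub.
Qed.

Lemma hs_pred_closed : zmod_closed hs_pred.
Proof.
split; first by apply/hs_predP; exact: fin_sums0.
move=> x y /hs_predP Sx /hs_predP Sy; apply/hs_predP; apply: fin_sumsD => //.
by apply: fin_sumsN => //; exact: hs_homN.
Qed.

HB.instance Definition _ := GRing.isZmodClosed.Build _ hs_pred hs_pred_closed.

Record hs_ring := HsRing { hs_val :> hs_amb H; hs_valP : hs_val \in hs_pred }.
HB.instance Definition _ := [isSub for hs_val].
HB.instance Definition _ := [Choice of hs_ring by <:].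
HB.instance Definition _ := [SubChoice_isSubZmodule of hs_ring by <:].

Lemma hs_ringS (x : hs_ring) : hs_sums (hs_val x).
Proof. exact/hs_predP/hs_valP. Qed.

Lemma hs_part_sums g x : @hs_part G H g x -> hs_sums x.
Proof. by move=> xg; apply: fin_sums1; exists g. Qed.

Lemma hs_mul0l (x : hs_amb H) : hs_sums x -> hs_mul 0 x = 0.
Proof.
move=> Sx; apply: (addIr (hs_mul 0 x)); rewrite add0r -hs_mulDl ?addr0 //;
  exact: fin_sums0.
Qed.

Lemma hs_mul0r (x : hs_amb H) : hs_sums x -> hs_mul x 0 = 0.
Proof.
move=> Sx; apply: (addIr (hs_mul x 0)); rewrite add0r -hs_mulDr ?addr0 //;
  exact: fin_sums0.
Qed.

Lemma hs_mul_sums (x y : hs_amb H) :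
  hs_sums x -> hs_sums y -> hs_sums (hs_mul x y).
Proof.
move=> Sx Sy; elim/fin_sums_ind: Sx => [|{}x x' hx Sx' IH].
  by rewrite hs_mul0l //; exact: fin_sums0.
have [g _ xg] := hx; have Sx := hs_part_sums xg.
rewrite hs_mulDl //; apply: fin_sumsD => // {x' hx Sx' IH}.
elim/fin_sums_ind: Sy => [|{}y y' hy Sy' IH].
  by rewrite hs_mul0r //; exact: fin_sums0.
have [h _ yh] := hy; have Sy := hs_part_sums yh.
rewrite hs_mulDr //; apply: fin_sumsD => //.
have [gh|gh] := pselect (gdom g = grng h).
  by apply: hs_part_sums; apply: hs_part_mul yh gh.
by rewrite (hs_part_mul0 xg yh gh); exact: fin_sums0.
Qed.

Definition hs_ring_mul (x y : hs_ring) : hs_ring :=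
  HsRing (introT (hs_predP _) (hs_mul_sums (hs_ringS x) (hs_ringS y))).

Definition hs_ring_one (e : gobj G) : hs_ring :=
  HsRing (introT (hs_predP _) (hs_part_sums (@hs_one_part G H e))).

Definition hs_ring_part (g : G) : set hs_ring := [set x | hs_part g (hs_val x)].

Lemma hs_ring_grading : is_grading hs_ring_part.
Proof.
split.
- move=> g; have [h0 hB] := @hs_sub G H g; split; first exact: h0.
  by move=> x y; exact: hB.
- apply/seteqP; split=> // x _.
  have [s [hs xs]] := hs_ringS x.
  have hs' : all (mem hs_pred) s.
    apply/allP => y /hs [g _ yg]; apply/hs_predP; exact: hs_part_sums yg.
  have [t st] : exists t : seq hs_ring, map hs_val t = s.
    elim: (s) hs' => [|a s' IH] /=; first by exists [::].
    by move=> /andP[ha /IH[t <-]]; exists (HsRing ha :: t).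
  exists t; split.
    move=> y yt; have /hs [g _ yg] : hs_val y \in s by rewrite -st map_f.
    by exists g.
  apply: val_inj; rewrite (big_morph val (id1 := 0) (op1 := +%R)) //=.
  by rewrite xs -st big_map.
- move=> n g x gI xC s0 i; apply: val_inj => /=.
  have /= := @hs_indep G H n g (fun i => hs_val (x i)) gI xC; apply.
  by have /(congr1 val) := s0; rewrite (big_morph val (id1 := 0) (op1 := +%R)).
Qed.

Definition gring_of : gring G.
Proof.
refine (@GRingG G hs_ring hs_ring_mul hs_ring_part hs_ring_one
  _ _ _ hs_ring_grading _ _ _ _ _).
- by move=> x y z; apply: val_inj; apply: hs_mulA; exact: hs_ringS.
- by move=> x y z; apply: val_inj; apply: hs_mulDl; exact: hs_ringS.
- by move=> x y z; apply: val_inj; apply: hs_mulDr; exact: hs_ringS.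
- by move=> g h a b ag bh; exact: hs_part_mul.
- by move=> g h a b ag bh gh; apply: val_inj; exact: hs_part_mul0 gh.
- by move=> e; exact: hs_one_part.
- by move=> g a ag; apply: val_inj; exact: hs_one_mul.
- by move=> g a ag; apply: val_inj; exact: hs_mul_one.
Defined.

End RingOf.

Definition dprod (J : Type) (V : J -> zmodType) := forall j, V j.

Section DProd.
Variables (J : Type) (V : J -> zmodType).

HB.instance Definition _ := gen_eqMixin (dprod V).
HB.instance Definition _ := gen_choiceMixin (dprod V).

Definition dprod_add (x y : dprod V) : dprod V := fun j => x j + y j.
Definition dprod_opp (x : dprod V) : dprod V := fun j => - x j.
Definition dprod_zero : dprod V := fun j => 0.

Lemma dprod_addA : associative dprod_add.
Proof. by move=> x y z; apply: functional_extensionality_dep => j; exact: addrA. Qed.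
Lemma dprod_addC : commutative dprod_add.
Proof. by move=> x y; apply: functional_extensionality_dep => j; exact: addrC. Qed.
Lemma dprod_add0 : left_id dprod_zero dprod_add.
Proof. by move=> x; apply: functional_extensionality_dep => j; exact: add0r. Qed.
Lemma dprod_addN : left_inverse dprod_zero dprod_opp dprod_add.
Proof. by move=> x; apply: functional_extensionality_dep => j; exact: addNr. Qed.

HB.instance Definition _ :=
  GRing.isZmodule.Build (dprod V) dprod_addA dprod_addC dprod_add0 dprod_addN.

Lemma dprod_sumE (I : Type) (r : seq I) (P : pred I) (F : I -> dprod V) j :
  (\sum_(i <- r | P i) F i) j = \sum_(i <- r | P i) F i j.
Proof. by rewrite (big_morph (fun x : dprod V => x j) (id1 := 0) (op1 := +%R)). Qed.

End DProd.

Section GrProd.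
Variables (G : groupoid) (J : Type) (R : J -> gring G).

Definition prod_part (g : G) : set (dprod R) := [set x | forall j, gpart g (x j)].

Definition prod_hsystem : hsystem G.
Proof.
refine (@HSystem G (dprod R) (fun x y j => x j ** y j) prod_part
  (fun e j => gone (R j) e) _ _ _ _ _ _ _ _ _ _).
- move=> g; split=> [j|x y xg yg j]; have [/(_ g)[h0 hB] _ _] := gpart_grading (R j).
    exact: h0.
  by apply: hB; [exact: xg|exact: yg].
- move=> n g x gI xC s0 i; apply: functional_extensionality_dep => j.
  have [_ _ ind] := gpart_grading (R j).
  apply: (ind n g (fun i => x i j) gI) => [k|]; first exact: xC.
  by rewrite -dprod_sumE s0.
- by move=> x y z _ _ _; apply: functional_extensionality_dep => j; exact: gmulA.
- by move=> x y z _ _ _; apply: functional_extensionality_dep => j; exact: gmulDl.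
- by move=> x y z _ _ _; apply: functional_extensionality_dep => j; exact: gmulDr.
- by move=> g h a b ag bh gh j; apply: gpart_mul gh; [exact: ag|exact: bh].
- move=> g h a b ag bh gh; apply: functional_extensionality_dep => j.
  by apply: gpart_mul0 gh; [exact: ag|exact: bh].
- by move=> e j; exact: gone_part.
- move=> g a ag; apply: functional_extensionality_dep => j.
  by apply: gone_mul; exact: ag.
- move=> g a ag; apply: functional_extensionality_dep => j.
  by apply: gmul_one; exact: ag.
Defined.

Definition gr_prod : gring G := gring_of prod_hsystem.

(* The graded product is equal to the direct sum, as subsets of the product. *)
Definition summable : Prop :=
  fin_sums (homogeneous prod_part) =
  [set x : dprod R | finite_set [set j | x j <> 0]].

End GrProd.

Definition d_finite (G : groupoid) (K : Type) (s : K -> G) : Prop :=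
  forall f : gobj G, finite_set [set k | gdom (s k) = f].

Record matricial (G : groupoid) (D : gring G) (K : Type) (S : K -> set G) : Prop :=
  Matricial {
  matricial_nonempty : forall k, S k !=set0;
  matricial_dom : forall k s t, S k s -> S k t -> gdom s = gdom t -> s = t;
  matricial_rng : forall k s t, S k s -> S k t -> grng s = grng t -> s = t;
  matricial_supp : forall k s, S k s -> obj_supp D (grng s);
  matricial_finite : forall f : gobj G,
    finite_set [set k | exists2 s, S k s & gdom s = f]
}.

(* The paper's [D_(S g T^-1)], which is zero when there are no such [s] and
   [t]; otherwise the disjunct [a = 0] is redundant. *)
Definition twisted_part (G : groupoid) (D : gring G) (S : set G) (g : G)
    (T : set G) : set D :=
  [set a | (exists s t, [/\ S s, T t, gdom s = grng g, gdom t = gdom g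
                          & gpart (gcomp (gcomp s g) (ginv t)) a]) \/ a = 0].

Section Matrix.
Variables (G : groupoid) (D : gring G) (K : Type) (S : K -> set G).

(* The sum is finite for matrices with finitely many nonzero entries. *)
Definition mx_mul (A B : K -> K -> D) : K -> K -> D := fun i j =>
  \sum_(k \in [set: {classic K}]) (A i k ** B k j).

Definition mx_part (g : G) : set (K -> K -> D) :=
  [set A | finite_set [set ij : K * K | A ij.1 ij.2 <> 0] /\
           forall i j, twisted_part (S i) g (S j) (A i j)].

(* Diagonal, with entry [1_(grng s)] at [k] if [s] in [S k] has domain [e]. *)
Definition mx_one (e : gobj G) : K -> K -> D := fun i j =>
  if pselect (i = j) is left _ then
    if pselect (exists2 s, S i s & gdom s = e) is left h
    then gone D (grng (projT1 (cid2 h))) else 0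
  else 0.


Lemma gmul0r (R : gring G) (x : R) : 0 ** x = 0.
Proof. by apply: (addIr (0 ** x)); rewrite -gmulDl !add0r. Qed.

Lemma gmulr0 (R : gring G) (x : R) : x ** 0 = 0.
Proof. by apply: (addIr (x ** 0)); rewrite -gmulDr !add0r. Qed.

Lemma gmul_suml (R : gring G) (I : Type) (r : seq I) (F : I -> R) x :
  (\sum_(i <- r) F i) ** x = \sum_(i <- r) F i ** x.
Proof.
rewrite (big_morph (fun y => y ** x) (id1 := 0) (op1 := +%R)) //.
  by move=> a b; exact: gmulDl.
exact: gmul0r.
Qed.

Lemma gmul_sumr (R : gring G) (I : Type) (r : seq I) (F : I -> R) x :
  x ** (\sum_(i <- r) F i) = \sum_(i <- r) x ** F i.
Proof.
rewrite (big_morph (fun y => x ** y) (id1 := 0) (op1 := +%R)) //.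
  by move=> a b; exact: gmulDr.
exact: gmulr0.
Qed.

Lemma gpart0 (g : G) : gpart g (0 : D).
Proof. by have [/(_ g)[]] := gpart_grading D. Qed.

Lemma gcomp_conj_inj (s t g s' t' g' : G) :
  (grng s = grng s' -> s = s') -> (grng t = grng t' -> t = t') ->
  gdom s = grng g -> gdom t = gdom g -> gdom s' = grng g' -> gdom t' = gdom g' ->
  gcomp (gcomp s g) (ginv t) = gcomp (gcomp s' g') (ginv t') -> g = g'.
Proof.
move=> ss tt sg tg sg' tg' E.
have dsg : gdom (gcomp s g) = grng (ginv t) by rewrite gdom_comp// grng_inv.
have dsg' : gdom (gcomp s' g') = grng (ginv t') by rewrite gdom_comp// grng_inv.
have {}ss : s = s'.
  by apply: ss; move: (congr1 (@grng G) E);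
    rewrite (grng_comp dsg) (grng_comp dsg') (grng_comp sg) (grng_comp sg').
have {}tt : t = t'.
  by apply: tt; move: (congr1 (@gdom G) E); rewrite (gdom_comp dsg) (gdom_comp dsg') !gdom_inv.
subst s' t'.
have cancel h : gdom s = grng h -> gdom t = gdom h ->
    gcomp (ginv s) (gcomp (gcomp (gcomp s h) (ginv t)) t) = h.
  move=> sh th; have dsh : gdom (gcomp s h) = gdom t by rewrite gdom_comp.
  rewrite -(gcompA (x := gcomp s h)) ?grng_inv ?gdom_inv // gcompVg -dsh gcompg1.
  by rewrite gcompA ?gdom_inv // gcompVg sh gcomp1g.
by rewrite -(cancel g) // E cancel.
Qed.

Definition mx_fin (A : K -> K -> D) :=
  exists r : seq {classic K}, uniq r /\
    forall i j : {classic K}, A i j <> 0 -> i \in r /\ j \in r.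

Lemma mx_finP A : finite_set [set ij : K * K | A ij.1 ij.2 <> 0] -> mx_fin A.
Proof.
move=> fA.
have /finite_seqP[r1 e1] := finite_image (fst : K * K -> {classic K}) fA.
have /finite_seqP[r2 e2] := finite_image (snd : K * K -> {classic K}) fA.
exists (undup (r1 ++ r2)); split; first exact: undup_uniq.
move=> i j Aij; rewrite !mem_undup !mem_cat; split; apply/orP.
  by left; have : [set` r1] i by rewrite -e1; exists (i, j).
by right; have : [set` r2] j by rewrite -e2; exists (i, j).
Qed.

Lemma mx_part_fin g A : mx_part g A -> mx_fin A.
Proof. by move=> [fA _]; exact: mx_finP. Qed.

Lemma mx_finD A B : mx_fin A -> mx_fin B -> mx_fin (A + B).
Proof.
move=> [r [_ Ar]] [t [_ Bt]]; exists (undup (r ++ t)); split.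
  exact: undup_uniq.
move=> i j; have [A0|/eqP A0] := eqVneq (A i j) 0.
  have [B0|/eqP B0 _] := eqVneq (B i j) 0.
    by case; change (A i j + B i j = 0); rewrite A0 B0 addr0.
  by have [? ?] := Bt _ _ B0; rewrite !mem_undup !mem_cat; split; apply/orP; right.
move=> _.
by have [? ?] := Ar _ _ A0; rewrite !mem_undup !mem_cat; split; apply/orP; left.
Qed.

Lemma mx_sums_fin A : fin_sums (homogeneous mx_part) A -> mx_fin A.
Proof.
elim/fin_sums_ind: A / => [|A B [g _ Ag] _ Bf].
  by exists [::].
by apply: mx_finD => //; exact: mx_part_fin Ag.
Qed.

Lemma mx_mulE (r : seq {classic K}) A B i j : uniq r ->
  (forall k : {classic K}, A i k <> 0 -> B k j <> 0 -> k \in r) ->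
  mx_mul A B i j = \sum_(k <- r) A i k ** B k j.
Proof.
move=> ur AB; rewrite /mx_mul (fsbigE r)//; first by apply: eq_bigl => k; rewrite in_setT.
move=> k _ kr; have [->|/eqP A0] := eqVneq (A i k) 0; first exact: gmul0r.
have [->|/eqP B0] := eqVneq (B k j) 0; first exact: gmulr0.
by rewrite AB in kr.
Qed.


Lemma mx_fin_cover A B C : mx_fin A -> mx_fin B -> mx_fin C ->
  exists r : seq {classic K}, uniq r /\ forall i j : {classic K},
    (A i j <> 0 -> i \in r /\ j \in r) /\
    (B i j <> 0 -> i \in r /\ j \in r) /\ (C i j <> 0 -> i \in r /\ j \in r).
Proof.
move=> [r [_ hr]] [s [_ hs]] [t [_ ht]].
exists (undup (r ++ s ++ t)); split; first exact: undup_uniq.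
move=> i j; rewrite !mem_undup !mem_cat; split; last split.
- by move=> /hr[-> ->].
- by move=> /hs[-> ->]; rewrite !orbT.
- by move=> /ht[-> ->]; rewrite !orbT.
Qed.

Lemma mx_mulA A B C : mx_fin A -> mx_fin B -> mx_fin C ->
  mx_mul A (mx_mul B C) = mx_mul (mx_mul A B) C.
Proof.
move=> fA fB fC; have [r [ur hr]] := mx_fin_cover fA fB fC.
apply/funext => i; apply/funext => j.
rewrite !(mx_mulE (r := r)) //.
- under eq_bigr => k _.
    rewrite (mx_mulE (r := r)) //; last first.
      by move=> l _ /(proj2 (proj2 (hr l j)))[].
    rewrite gmul_sumr; over.
  under [RHS]eq_bigr => k _.
    rewrite (mx_mulE (r := r)) //; last first.
      by move=> l /(proj1 (hr i l))[].
    rewrite gmul_suml; over.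
  rewrite exchange_big /=; apply: eq_bigr => k _; apply: eq_bigr => l _.
  exact: gmulA.
- by move=> k _ /(proj2 (proj2 (hr k j)))[].
- by move=> k /(proj1 (hr i k))[].
Qed.

Lemma mx_mulDl A B C : mx_fin A -> mx_fin B -> mx_fin C ->
  mx_mul (A + B) C = mx_mul A C + mx_mul B C.
Proof.
move=> fA fB fC; have [r [ur hr]] := mx_fin_cover fA fB fC.
apply/funext => i; apply/funext => j; change (mx_mul (A + B) C i j =
  mx_mul A C i j + mx_mul B C i j).
have hC k : C k j <> 0 -> k \in r by move=> /(proj2 (proj2 (hr k j)))[].
rewrite !(mx_mulE (r := r)) //; try by move=> k _ /hC.
by rewrite -big_split; apply: eq_bigr => k _; exact: gmulDl.
Qed.

Lemma mx_mulDr A B C : mx_fin A -> mx_fin B -> mx_fin C ->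
  mx_mul A (B + C) = mx_mul A B + mx_mul A C.
Proof.
move=> fA fB fC; have [r [ur hr]] := mx_fin_cover fA fB fC.
apply/funext => i; apply/funext => j; change (mx_mul A (B + C) i j =
  mx_mul A B i j + mx_mul A C i j).
have hA k : A i k <> 0 -> k \in r by move=> /(proj1 (hr i k))[].
rewrite !(mx_mulE (r := r)) //; try by move=> k /hA.
by rewrite -big_split; apply: eq_bigr => k _; exact: gmulDr.
Qed.

Hypothesis hS : matricial D S.

Lemma twisted_part_sub g i j :
  additive_subgroup (twisted_part (D := D) (S i) g (S j)).
Proof.
split; first by right.
move=> x y [[s [t [Ss St sg tg xp]]]|->]; last first.
  case=> [[s [t [Ss St sg tg yp]]]|->]; last by right; rewrite subr0.
  left; exists s, t; split=> //; have [/(_ (gcomp (gcomp s g) (ginv t)))] := gpart_grading D.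
  by move=> hp _ _; rewrite sub0r; exact: additive_subgroupN.
case=> [[s' [t' [Ss' St' sg' tg' yp]]]|->]; last first.
  by rewrite subr0; left; exists s, t.
have es : s' = s by apply: (matricial_dom hS Ss' Ss); rewrite sg.
have et : t' = t by apply: (matricial_dom hS St' St); rewrite tg.
subst s' t'; left; exists s, t; split=> //.
by have [/(_ (gcomp (gcomp s g) (ginv t)))[_ hB] _ _] := gpart_grading D; apply: hB.
Qed.

Lemma mx_fin_set A : mx_fin A -> finite_set [set ij : K * K | A ij.1 ij.2 <> 0].
Proof.
move=> [r [_ hr]].
apply: (@sub_finite_set _ _ ([set` r] `*` [set` r] : set ({classic K} * {classic K}))).
  by move=> [a b] /= /hr[].
by apply: finite_setX.
Qed.

Lemma mx_part_sub g : additive_subgroup (mx_part g).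
Proof.
split.
  split; last by move=> i j; right.
  by apply: mx_fin_set; exists [::].
move=> A B [fA hA] [fB hB]; split; last first.
  by move=> i j; have [_] := twisted_part_sub g i j; apply.
apply: mx_fin_set; apply: mx_finD; first exact: mx_finP.
have [r [ur hr]] := mx_finP fB; exists r; split=> // i j Bij; apply: hr.
by move=> B0; apply: Bij; change (- B i j = 0); rewrite B0 oppr0.
Qed.

Lemma mx_sumE (I : Type) (r : seq I) (P : pred I) (F : I -> K -> K -> D) i j :
  (\sum_(k <- r | P k) F k) i j = \sum_(k <- r | P k) F k i j.
Proof.
by rewrite (big_morph (fun A : K -> K -> D => A i j) (id1 := 0) (op1 := +%R)).
Qed.

Lemma mx_indep : independent_family mx_part.
Proof.
move=> n g x gI xC s0 k; apply/funext => i; apply/funext => j.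
change (x k i j = 0); have [->//|/eqP nz] := eqVneq (x k i j) 0.
have [_ _ ind] := gpart_grading D.
pose P : pred 'I_n := fun l => x l i j != 0.
have hP l : P l -> {st : G * G | [/\ S i st.1, S j st.2, gdom st.1 = grng (g l),
    gdom st.2 = gdom (g l)
    & gpart (gcomp (gcomp st.1 (g l)) (ginv st.2)) (x l i j)]}.
  move=> /eqP Pl; apply/cid; have [_ /(_ i j)[[s [t h]]|//]] := xC l.
  by exists (s, t).
pose st l := if pselect (P l) is left Pl then sval (hP l Pl) else (g l, g l).
have hst l : P l -> [/\ S i (st l).1, S j (st l).2, gdom (st l).1 = grng (g l),
    gdom (st l).2 = gdom (g l)
    & gpart (gcomp (gcomp (st l).1 (g l)) (ginv (st l).2)) (x l i j)].
  move=> Pl; rewrite /st; case: pselect => // Pl'.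
  exact: (svalP (hP l Pl')).
apply: (independent_cond ind (P := P)
  (g := fun l => gcomp (gcomp (st l).1 (g l)) (ginv (st l).2))
  (x := fun l => x l i j)); last by apply/eqP.
- move=> a b Pa Pb; have [a1 a2 a3 a4 _] := hst a Pa.
  have [b1 b2 b3 b4 _] := hst b Pb => E; apply: gI.
  by apply: gcomp_conj_inj a3 a4 b3 b4 E;
    [exact: (matricial_rng hS a1 b1)|exact: (matricial_rng hS a2 b2)].
- by move=> l /hst[].
- have := congr1 (fun A : K -> K -> D => A i j) s0; rewrite mx_sumE (bigID P) /=.
  by rewrite [X in _ + X = _]big1 ?addr0 // => l; rewrite negbK => /eqP.
Qed.

Lemma mx_part_mul g h A B : mx_part g A -> mx_part h B -> gdom g = grng h ->
  mx_part (gcomp g h) (mx_mul A B).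
Proof.
move=> hA hB gh; have fA := mx_part_fin hA; have fB := mx_part_fin hB.
have [r [ur hr]] := mx_fin_cover fA fB fB.
have hE i j : mx_mul A B i j = \sum_(k <- r) A i k ** B k j.
  by apply: mx_mulE => // k /(proj1 (hr i k))[].
split.
  apply: mx_fin_set; exists r; split=> // i j; rewrite hE => nz.
  split; apply: contrapT => nr; apply: nz; rewrite big1 // => k _.
    have [->|/eqP/(proj1 (hr i k))[]//] := eqVneq (A i k) 0.
    exact: gmul0r.
  have [->|/eqP/(proj1 (proj2 (hr k j)))[]//] := eqVneq (B k j) 0.
  exact: gmulr0.
move=> i j; rewrite hE; have tsub := twisted_part_sub (gcomp g h) i j.
apply: (big_ind (twisted_part (D := D) (S i) (gcomp g h) (S j))).
- by have [] := tsub.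
- by move=> x y; exact: additive_subgroupD.
move=> k _; have [_ /(_ i k)[[s [t [Ss St sg tg xp]]]|->]] := hA; last first.
  by right; exact: gmul0r.
have [_ /(_ k j)[[t' [u [St' Su th uh yp]]]|->]] := hB; last first.
  by right; exact: gmulr0.
have et : t' = t by apply: (matricial_dom hS St' St); rewrite th tg.
subst t'; left; exists s, u; split; rewrite ?grng_comp ?gdom_comp //.
have dsg : gdom (gcomp s g) = grng (ginv t) by rewrite gdom_comp// grng_inv.
have dth : gdom (gcomp t h) = grng (ginv u) by rewrite gdom_comp// grng_inv.
have dhu : gdom h = grng (ginv u) by rewrite grng_inv.
have sgh : gdom (gcomp s g) = grng h by rewrite gdom_comp.
have -> : gcomp (gcomp s (gcomp g h)) (ginv u) =
  gcomp (gcomp (gcomp s g) (ginv t)) (gcomp (gcomp t h) (ginv u)).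
  rewrite -(gcompA (x := gcomp s g)) //; last first.
    by rewrite (grng_comp dth) (grng_comp th) gdom_inv.
  rewrite (gcompA (x := ginv t)) ?gdom_inv ?(grng_comp th) //.
  rewrite (gcompA (x := ginv t)) ?gdom_inv // gcompVg th gcomp1g.
  by rewrite (gcompA (x := gcomp s g)) // (gcompA (x := s)).
apply: gpart_mul => //; rewrite (gdom_comp dsg) (grng_comp dth) (grng_comp th).
by rewrite gdom_inv.
Qed.

Lemma mx_part_mul0 g h A B : mx_part g A -> mx_part h B -> gdom g <> grng h ->
  mx_mul A B = 0.
Proof.
move=> hA hB gh; have fA := mx_part_fin hA; have fB := mx_part_fin hB.
have [r [ur hr]] := mx_fin_cover fA fB fB.
apply/funext => i; apply/funext => j; change (mx_mul A B i j = 0).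
rewrite (mx_mulE (r := r)) //; last by move=> k /(proj1 (hr i k))[].
apply: big1 => k _; have [_ /(_ i k)[[s [t [Ss St sg tg xp]]]|->]] := hA; last first.
  exact: gmul0r.
have [_ /(_ k j)[[t' [u [St' Su th uh yp]]]|->]] := hB; last exact: gmulr0.
have dsg : gdom (gcomp s g) = grng (ginv t) by rewrite gdom_comp// grng_inv.
have dth : gdom (gcomp t' h) = grng (ginv u) by rewrite gdom_comp// grng_inv.
apply: gpart_mul0 xp yp _.
rewrite (gdom_comp dsg) (grng_comp dth) (grng_comp th) gdom_inv => ett.
have et : t = t' by exact: (matricial_rng hS St St').
by apply: gh; rewrite -tg -th et.
Qed.

Lemma mx_one_neq e i j : i <> j -> mx_one e i j = 0.
Proof. by move=> ij; rewrite /mx_one; case: pselect. Qed.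

Lemma mx_one_eq e i s : S i s -> gdom s = e ->
  mx_one e i i = gone D (grng s).
Proof.
move=> Ss se; rewrite /mx_one; case: pselect => // _.
case: pselect => [h|[]]; last by exists s.
congr (gone D (grng _)); apply: (matricial_dom hS (k := i)) => //.
  exact: (s2valP (cid2 h)).
by rewrite se; exact: (s2valP' (cid2 h)).
Qed.

Lemma mx_one_part e : mx_part (gid e) (mx_one e).
Proof.
split.
  apply: (@sub_finite_set _ _ ((fun k => (k, k)) @`
    [set k | exists2 s, S k s & gdom s = e])); last first.
    by apply: finite_image; exact: (matricial_finite hS).
  move=> [i j] /=; rewrite /mx_one; case: pselect => [<-|//].
  by case: pselect => // h _; exists i.
move=> i j; have [<-|ij] := pselect (i = j); last first.
  by right; exact: mx_one_neq.
have [[s Ss se]|h] := pselect (exists2 s, S i s & gdom s = e); last first.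
  by right; rewrite /mx_one; case: pselect => // _; case: pselect.
left; exists s, s; rewrite grng_id gdom_id; split=> //.
rewrite (mx_one_eq Ss se) -se gcompg1 gcompgV; exact: gone_part.
Qed.

Lemma mx_one_mul g A : mx_part g A -> mx_mul (mx_one (grng g)) A = A.
Proof.
move=> hA; apply/funext => i; apply/funext => j.
rewrite (mx_mulE (r := [:: i])) //; last first.
  by move=> k /(contra_not (@mx_one_neq _ i k))/contrapT ->; rewrite mem_head.
rewrite big_seq1; have [_ /(_ i j)[[s [t [Ss St sg tg xp]]]|->]] := hA; last first.
  exact: gmulr0.
rewrite (mx_one_eq Ss sg).
have dsg : gdom (gcomp s g) = grng (ginv t) by rewrite gdom_comp// grng_inv.
by have := gone_mul xp; rewrite (grng_comp dsg) (grng_comp sg).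
Qed.

Lemma mx_mul_one g A : mx_part g A -> mx_mul A (mx_one (gdom g)) = A.
Proof.
move=> hA; apply/funext => i; apply/funext => j.
rewrite (mx_mulE (r := [:: j])) //; last first.
  by move=> k _ /(contra_not (@mx_one_neq _ k j))/contrapT ->; rewrite mem_head.
rewrite big_seq1; have [_ /(_ i j)[[s [t [Ss St sg tg xp]]]|->]] := hA; last first.
  exact: gmul0r.
rewrite (mx_one_eq St tg).
have dsg : gdom (gcomp s g) = grng (ginv t) by rewrite gdom_comp// grng_inv.
by have := gmul_one xp; rewrite (gdom_comp dsg) gdom_inv.
Qed.

Definition mx_hsystem : hsystem G.
Proof.
refine (@HSystem G (K -> K -> D) mx_mul mx_part (mx_one) mx_part_sub mx_indep
  _ _ _ mx_part_mul mx_part_mul0 mx_one_part mx_one_mul mx_mul_one).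
- by move=> A B C /mx_sums_fin fA /mx_sums_fin fB /mx_sums_fin fC; exact: mx_mulA.
- by move=> A B C /mx_sums_fin fA /mx_sums_fin fB /mx_sums_fin fC; exact: mx_mulDl.
- by move=> A B C /mx_sums_fin fA /mx_sums_fin fB /mx_sums_fin fC; exact: mx_mulDr.
Defined.

Definition mx_gring : gring G := gring_of mx_hsystem.

End Matrix.

Section Singletons.
Variables (G : groupoid) (D : gring G) (e : gobj G) (K : Type) (s : K -> G).
Hypotheses (hD : gr_division D) (suppD : supp D `<=` ghom e e).
Hypotheses (rng_s : forall k, grng (s k) = e) (fin_s : d_finite s).

Lemma obj_supp_division : obj_supp D e.
Proof.
move=> e0; have [D0 _] := hD; apply: D0; apply/seteqP; split=> // x _.
have [_ full _] := gpart_grading D.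
have : fin_sums (homogeneous (@gpart _ D)) x by rewrite full.
elim/fin_sums_ind: x / => [|x y [g _ xg] _ ->]; first by [].
rewrite /= addr0; have [->//|/eqP x0] := eqVneq x 0.
have [re _] : ghom e e g by apply: suppD; exists x.
by rewrite -(gone_mul xg) re e0 gmul0r.
Qed.

Lemma matricial_singleton : matricial D (fun k => [set s k]).
Proof.
split.
- by move=> k; exists (s k).
- by move=> k _ _ -> ->.
- by move=> k _ _ -> ->.
- by move=> k _ ->; rewrite rng_s; exact: obj_supp_division.
- move=> f; apply: sub_finite_set (fin_s f) => k [_ -> <-] //.
Qed.

Definition mx_gring1 : gring G := mx_gring matricial_singleton.

End Singletons.

(* Main.v *)
Require Import Defs.
From mathcomp Require Import all_boot all_algebra.
From mathcomp Require Import all_classical.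

Set Implicit Arguments.
Unset Strict Implicit.
Unset Printing Implicit Defensive.

Import GRing.Theory.
Local Open Scope classical_set_scope.
Local Open Scope ring_scope.
Local Open Scope gring_scope.

(** This is the Wedderburn-Artin theorem for rings graded by a groupoid. As the
    ring need not be unital, its role is taken by the identities [1_e] of the
    objects, and every finiteness statement is made at one object at a time.

    All arguments are carried by homogeneous elements. A graded right ideal is
    gr-simple when each of its nonzero homogeneous elements generates it, and a
    minimal idempotent at [e] is an idempotent [p] of degree [gid e] for which
    [p R] is gr-simple.

    From a gr-semisimple ring to matrices: [1_e] is a finite sum of elements of
    gr-simple right ideals. Graded right ideals inside [1_e R] have complements, hence
    are generated by idempotents ([rideal_idem]), and an orthogonalization writes
    [1_e] as a sum of orthogonal minimal idempotents ([orthogonal_decomp]). Gathered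
    over all objects these form one orthogonal system [p k] ([idem_system]). By
    Schur's lemma ([min_idem_link]) a nonzero homogeneous element of [p k R p l] is
    invertible between [p k] and [p l]; so [p k R p k] is a graded division ring, and
    being linked by such an element is an equivalence relation. In each class fix
    a representative [j] and elements [u k] of [p j R p k], of degree [s k], with
    inverses [v k]. Then [x] goes to the matrices [(u k) x (v l)], one for each class.
    This is a graded isomorphism ([class_mx_iso]): the sum of the [p k] at an object is
    [1_e], and blocks between different classes are zero. Finitely many
    idempotents at each object give both summability and [d]-finiteness.

    A graded division ring supported on one object is gr-prime, because each of its
    nonzero graded ideals contains the identity of the object ([division_prime]).

    Matrix rings over a gr-prime graded division ring are gr-simple and artinian at
    each object: their diagonal idempotents are minimal, sum to the object
    identities, and are pairwise linked since gr-primeness connects any two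
    objects in the support of [D] ([prime_connected]). Both properties follow for any
    ring with such a system of idempotents ([framed_simple], [framed_artinian]).

    Finally, a gr-simple artinian ring has a gr-simple right ideal, and the sum of
    all of them is a nonzero graded ideal, hence the whole ring
    ([simple_artinian_semisimple]). A summable product of such rings is their
    direct sum, and is again a sum of gr-simple right ideals ([semisimple_prod]). *)

(** * Groupoid identities *)

Section Groupoid.
Variable G : groupoid.
Implicit Types g h k s t : G.

Lemma gcompKl g h : gdom g = grng h -> gcomp (ginv g) (gcomp g h) = h.
Proof. by move=> gh; rewrite gcompA ?gdom_inv// gcompVg gh gcomp1g. Qed.

Lemma gcompKr g h : gdom g = grng h -> gcomp (gcomp g h) (ginv h) = g.
Proof. by move=> gh; rewrite -gcompA ?grng_inv// gcompgV -gh gcompg1. Qed.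

Lemma ginvK g : ginv (ginv g) = g.
Proof.
have := @gcompKl (ginv g) g; rewrite gdom_inv => /(_ erefl).
by rewrite gcompVg -(grng_inv g) -gdom_inv gcompg1.
Qed.

Lemma gcomp_twistK s g t : gdom s = grng g -> gdom t = gdom g ->
  gcomp (gcomp (ginv s) (gcomp (gcomp s g) (ginv t))) t = g.
Proof.
move=> sg tg; have dsg : gdom (gcomp s g) = grng (ginv t).
  by rewrite gdom_comp// grng_inv.
have d1 : gdom (ginv s) = grng (gcomp (gcomp s g) (ginv t)).
  by rewrite gdom_inv (grng_comp dsg) (grng_comp sg).
have d2 : gdom (gcomp (gcomp s g) (ginv t)) = grng t.
  by rewrite (gdom_comp dsg) gdom_inv.
rewrite -(gcompA d1 d2) -(gcompA dsg) ?gdom_inv// gcompVg tg.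
by rewrite -(gdom_comp sg) gcompg1 gcompKl.
Qed.

Lemma gcomp_untwist s h t : grng h = grng s -> gdom h = grng t ->
  gcomp (gcomp s (gcomp (gcomp (ginv s) h) t)) (ginv t) = h.
Proof.
move=> hs ht; have sh : gdom (ginv s) = grng h by rewrite gdom_inv.
have sht : gdom (gcomp (ginv s) h) = grng t by rewrite gdom_comp.
have d1 : gdom s = grng (gcomp (gcomp (ginv s) h) t).
  by rewrite (grng_comp sht) (grng_comp sh) grng_inv.
have d2 : gdom (gcomp (gcomp (ginv s) h) t) = grng (ginv t).
  by rewrite (gdom_comp sht) grng_inv.
rewrite -(gcompA d1 d2) (gcompKr sht) -[in X in gcomp X _](ginvK s).
exact: gcompKl.
Qed.

End Groupoid.

(** * Homogeneous components *)

Section Components.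
Variables (G : groupoid) (R : gring G).
Implicit Types (g h k : G) (x y z a b : R) (e f : gobj G).

Lemma gpart_sub g : additive_subgroup (@gpart G R g).
Proof. by have [] := gpart_grading R. Qed.

Lemma gpart_zero g : gpart g (0 : R). Proof. by have [] := gpart_sub g. Qed.

Lemma gpartD g x y : gpart g x -> gpart g y -> gpart g (x + y).
Proof. exact: (additive_subgroupD (@gpart_sub g)). Qed.

Lemma gpartN g x : gpart g x -> gpart g (- x).
Proof. exact: (additive_subgroupN (@gpart_sub g)). Qed.

Lemma gpartB g x y : gpart g x -> gpart g y -> gpart g (x - y).
Proof. by have [_] := gpart_sub g; apply. Qed.

Lemma gpart_sum g (I : Type) (r : seq I) (P : pred I) (F : I -> R) :
  (forall i, P i -> gpart g (F i)) -> gpart g (\sum_(i <- r | P i) F i).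
Proof.
move=> h; apply: big_ind => //; [exact: gpart_zero|exact: gpartD].
Qed.

Lemma gmulBl x y z : (x - y) ** z = x ** z - y ** z.
Proof.
rewrite gmulDl; congr (_ + _); apply: (addIr (y ** z)).
by rewrite -gmulDl !addNr gmul0r.
Qed.

Lemma gmulBr x y z : z ** (x - y) = z ** x - z ** y.
Proof.
rewrite gmulDr; congr (_ + _); apply: (addIr (z ** y)).
by rewrite -gmulDr !addNr gmulr0.
Qed.

(** Elements are sums of homogeneous ones, so additive properties need only be
    tested in each degree. *)
Lemma homog_ind (P : R -> Prop) :
  P 0 -> (forall g x, gpart g x -> P x) ->
  (forall x y, P x -> P y -> P (x + y)) -> forall x, P x.
Proof.
move=> P0 Ph PD x; have [_ full _] := gpart_grading R.
have : fin_sums (homogeneous (@gpart _ R)) x by rewrite full.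
by elim/fin_sums_ind => // {}x y [g _ xg] _; apply: PD; apply: Ph xg.
Qed.

Lemma gpart_hom_mul g h a b : gpart g a -> gpart h b ->
  homogeneous (@gpart G R) (a ** b).
Proof.
move=> ag bh; have [gh|gh] := pselect (gdom g = grng h).
  by exists (gcomp g h) => //; exact: gpart_mul.
by exists g => //; rewrite (gpart_mul0 ag bh gh); exact: gpart_zero.
Qed.

(** Terms of equal degree in a sum of homogeneous elements are collected, which
    makes the independence of the components applicable. *)
Lemma sum_by_degree (A : set G) z :
  fin_sums (\bigcup_(h in A) @gpart G R h) z ->
  exists (gs : seq {classic G}) (c : G -> R), [/\ uniq gs,
    forall h : {classic G}, h \in gs -> A h /\ gpart h (c h)
    & z = \sum_(h <- gs) c h].
Proof.
elim/fin_sums_ind => [|x y [g Ag xg] _ [gs [c [us hc ->]]]].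
  by exists [::], (fun _ => 0); rewrite big_nil.
pose g' : {classic G} := g.
have [gin|gout] := boolP (g' \in gs).
  exists gs, (fun h => if (h : {classic G}) == g' then x + c h else c h).
  split=> // [h hin|].
    have [Ah ch] := hc h hin; split=> //; case: eqP => // ->.
    by apply: gpartD => //; have [_] := hc g' gin.
  rewrite (bigD1_seq g') //= [RHS](bigD1_seq g') //= eqxx addrA; congr (_ + _).
  by apply: eq_bigr => h /negPf ->.
exists (g' :: gs), (fun h => if (h : {classic G}) == g' then x else c h).
split; first by rewrite /= gout.
- move=> h; rewrite inE; case: eqP => [->//|_ /= /hc]; exact.
- rewrite big_cons eqxx; congr (_ + _); apply: eq_big_seq => h hin.
  by case: eqP => // hg; rewrite -hg hin in gout.
Qed.

Lemma uniq_degrees_eq0 (gs : seq {classic G}) (c : G -> R) : uniq gs ->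
  (forall h : {classic G}, h \in gs -> gpart h (c h)) ->
  \sum_(h <- gs) c h = 0 -> forall h : {classic G}, h \in gs -> c h = 0.
Proof.
move=> ugs hc s0 h hin; have [_ _ ind] := gpart_grading R.
pose t := fun i : 'I_(size gs) => tnth (in_tuple gs) i.
have tI : injective t by apply/tuple_uniqP.
have s0' : \sum_(i < size gs) c (t i) = 0 by rewrite -[RHS]s0 [RHS]big_tnth.
have hi : (index h gs < size gs)%N by rewrite index_mem.
have := ind _ t (fun i => c (t i)) tI _ s0' (Ordinal hi).
rewrite /t (tnth_nth h) /= nth_index //; apply=> i.
by apply: hc; exact: mem_tnth.
Qed.

Definition off_degree g : set R := \bigcup_(h in [set h | h <> g]) gpart h.

(** Subtracting [y] from its expression in the other degrees is a relation between
    distinct components. *)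
Lemma off_degree_eq0 g y : gpart g y -> fin_sums (off_degree g) y -> y = 0.
Proof.
move=> yg /sum_by_degree[gs [c [us hc ys]]].
pose g' : {classic G} := g.
have gout : g' \notin gs by apply/negP => /hc[].
pose c' (h : G) := if (h : {classic G}) == g' then - y else c h.
have /(_ g') : forall h : {classic G}, h \in g' :: gs -> c' h = 0.
  apply: uniq_degrees_eq0; first by rewrite /= gout.
    move=> h; rewrite inE /c'; case: eqP => [->_|_ /= /hc[]//].
    exact: gpartN.
  rewrite big_cons /c' eqxx {1}ys; apply/eqP; rewrite addrC subr_eq0; apply/eqP.
  by apply: eq_big_seq => h hin; case: eqP => // hg; rewrite -hg hin in gout.
by rewrite mem_head /c' eqxx => /(_ isT)/eqP; rewrite oppr_eq0 => /eqP.
Qed.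

Lemma off_degreeN g x : off_degree g x -> off_degree g (- x).
Proof. by move=> [h hg xh]; exists h => //; exact: gpartN. Qed.

Lemma gproj_ex g x : exists y, gpart g y /\ fin_sums (off_degree g) (x - y).
Proof.
elim/homog_ind: x => [|h x xh|x x' [y [yg xy]] [y' [yg' xy']]].
- by exists 0; split; [exact: gpart_zero|rewrite subr0; exact: fin_sums0].
- have [hg|hg] := pselect (h = g).
    by exists x; rewrite -{1}hg subrr; split=> //; exact: fin_sums0.
  exists 0; split; first exact: gpart_zero.
  by rewrite subr0; apply: fin_sums1; exists h.
- exists (y + y'); split; first exact: gpartD.
  by rewrite opprD addrACA; exact: fin_sumsD.
Qed.

Definition gproj g x : R := projT1 (cid (gproj_ex g x)).

Lemma gproj_part g x : gpart g (gproj g x).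
Proof. by rewrite /gproj; case: cid => y []. Qed.

Lemma gproj_uniq g x y :
  gpart g y -> fin_sums (off_degree g) (x - y) -> gproj g x = y.
Proof.
move=> yg xy; rewrite /gproj; case: cid => z [zg xz] /=; apply/eqP.
rewrite -subr_eq0; apply/eqP; apply: off_degree_eq0 (gpartB zg yg) _.
have -> : z - y = (x - y) + - (x - z) by rewrite opprB [RHS]addrC addrA subrK.
by apply: fin_sumsD => //; apply: fin_sumsN => //; exact: off_degreeN.
Qed.

Lemma gproj_id g x : gpart g x -> gproj g x = x.
Proof. by move=> xg; apply: gproj_uniq => //; rewrite subrr; exact: fin_sums0. Qed.

Lemma gproj_off g h x : gpart h x -> h <> g -> gproj g x = 0.
Proof.
move=> xh hg; apply: gproj_uniq; first exact: gpart_zero.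
by rewrite subr0; apply: fin_sums1; exists h.
Qed.

Lemma gprojD g x y : gproj g (x + y) = gproj g x + gproj g y.
Proof.
apply: gproj_uniq; first by apply: gpartD; exact: gproj_part.
rewrite opprD addrACA; apply: fin_sumsD; rewrite /gproj;
  by case: cid => z [].
Qed.

Lemma gproj0 g : gproj g (0 : R) = 0.
Proof. by apply: gproj_id; exact: gpart_zero. Qed.

Lemma gproj_sum g (I : Type) (r : seq I) (F : I -> R) :
  gproj g (\sum_(i <- r) F i) = \sum_(i <- r) gproj g (F i).
Proof.
by rewrite (big_morph (gproj g) (id1 := 0) (op1 := +%R)) ?gproj0 //; exact: gprojD.
Qed.

Lemma gproj_decomp x : exists (gs : seq {classic G}), x = \sum_(h <- gs) gproj h x.
Proof.
have [_ full _] := gpart_grading R.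
have : fin_sums (homogeneous (@gpart _ R)) x by rewrite full.
move=> /sum_by_degree[gs [c [us hc xs]]].
exists gs; rewrite {1}xs; apply: eq_big_seq => h hin.
rewrite xs gproj_sum (bigD1_seq h) //= gproj_id; last by have [] := hc h hin.
rewrite big_seq_cond big1 ?addr0 // => h' /andP[/hc[_ ch'] /eqP hh'].
exact: gproj_off ch' hh'.
Qed.

Lemma gproj_neq0 x : x <> 0 -> exists g, gproj g x <> 0.
Proof.
move=> x0; apply: contrapT => h; apply: x0; have [gs ->] := gproj_decomp x.
by rewrite big1 // => g _; apply: contrapT => hg; apply: h; exists g.
Qed.

(** Left multiplication by an element of degree [g] is injective on the degrees
    composable with [g], so it cannot mix components. *)
Lemma gproj_mull g h x y : gpart g x -> gdom g = grng h ->
  gproj (gcomp g h) (x ** y) = x ** gproj h y.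
Proof.
move=> xg gh; elim/homog_ind: y => [|k y yk|y y' IH IH'].
- by rewrite gproj0 gmulr0 gproj0.
- have [kh|kh] := pselect (k = h).
    rewrite kh in yk; rewrite (gproj_id yk) gproj_id //; exact: gpart_mul.
  rewrite (gproj_off yk kh) gmulr0; have [gk|gk] := pselect (gdom g = grng k).
    apply: gproj_off (gpart_mul xg yk gk) _ => e; apply: kh.
    by rewrite -(gcompKl gk) e gcompKl.
  by rewrite (gpart_mul0 xg yk gk) gproj0.
- by rewrite gmulDr !gprojD IH IH' gmulDr.
Qed.

Lemma gone_mul_neq e g x : gpart g x -> e <> grng g -> gone R e ** x = 0.
Proof.
move=> xg eg; apply: gpart_mul0 (gone_part R e) xg _.
by rewrite gdom_id.
Qed.

Lemma gone_idem e : gone R e ** gone R e = gone R e.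
Proof. by have := gone_mul (gone_part R e); rewrite grng_id. Qed.

Lemma gpart_deg_uniq g h x : gpart g x -> gpart h x -> x <> 0 -> g = h.
Proof.
move=> xg xh x0; apply: contrapT => gh; apply: x0.
by rewrite -(gproj_id xh); exact: gproj_off xg gh.
Qed.

Lemma hom_mul_neq0 g h x y : gpart g x -> gpart h y -> x ** y <> 0 -> gdom g = grng h.
Proof. by move=> xg yh xy; apply: contrapT => /(gpart_mul0 xg yh). Qed.

End Components.

(** * Graded right ideals *)

Lemma sum_neq0 (V : zmodType) (I : eqType) (r : seq I) (F : I -> V) :
  \sum_(i <- r) F i <> 0 -> exists2 i, i \in r & F i <> 0.
Proof.
move=> s0; apply: contrapT => h; apply: s0; rewrite big_seq big1 // => i ir.
by apply: contrapT => Fi; apply: h; exists i.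
Qed.

Section RightIdeals.
Variables (G : groupoid) (R : gring G).
Implicit Types (g h k : G) (x y z a b : R) (e f : gobj G) (N S T : set R).

Lemma gproj_mull_cases g k x y : gpart g x -> gproj k (x ** y) <> 0 ->
  exists h, [/\ gdom g = grng h, k = gcomp g h
    & gproj k (x ** y) = x ** gproj h y].
Proof.
move=> xg; have [gs ys] := gproj_decomp y.
rewrite {1}ys gmul_sumr gproj_sum => /sum_neq0[h _ n0].
have gh : gdom g = grng h.
  apply: contrapT => gh; apply: n0.
  by rewrite (gpart_mul0 xg (gproj_part h y) gh) gproj0.
have kgh : k = gcomp g h.
  apply: contrapT => kgh; apply: n0.
  apply: gproj_off (gpart_mul xg (gproj_part h y) gh) _ => e.
  exact/kgh/esym.
by exists h; split=> //; rewrite kgh gproj_mull.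
Qed.

(** Comparing the components of degree [k] in [x = a y] replaces [y] by one of its
    components. *)
Lemma hom_quotient g k x a y : gpart g a -> gpart k x -> x = a ** y -> x <> 0 ->
  exists h, [/\ gdom g = grng h, k = gcomp g h & x = a ** gproj h y].
Proof.
move=> ag xk xay x0; have := @gproj_mull_cases g k a y ag.
by rewrite -xay (gproj_id xk); apply.
Qed.

(** Graded submodules of the regular module, with gradedness expressed by
    closure under components, the form in which it is checked and used. *)
Definition rideal N := [/\ additive_subgroup N, forall x a, N x -> N (x ** a)
  & forall g x, N x -> N (gproj g x)].

Lemma subgroup_sum N (I : eqType) (r : seq I) (F : I -> R) :
  additive_subgroup N -> (forall i, i \in r -> N (F i)) -> N (\sum_(i <- r) F i).
Proof.
move=> hN hF; rewrite big_seq; apply: big_ind; first by have [] := hN.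
  by move=> x y; exact: additive_subgroupD.
exact: hF.
Qed.

(** The component of degree [g] of a sum of homogeneous elements of [N] is the sum of
    the terms of degree [g], so it stays in [N]. *)
Lemma graded_gproj N : additive_subgroup N ->
  N `<=` fin_sums (N `&` homogeneous (@gpart G R)) <->
  forall g x, N x -> N (gproj g x).
Proof.
move=> hN; split.
  move=> hs g x /hs[s [ss ->]]; rewrite gproj_sum; apply: subgroup_sum => // y.
  move=> /ss[Ny [h _ yh]]; have [hg|hg] := pselect (h = g).
    by rewrite -hg (gproj_id yh).
  by rewrite (gproj_off yh hg); have [] := hN.
move=> hp x Nx; have [gs xs] := gproj_decomp x.
exists [seq gproj h x | h : {classic G} <- gs]; rewrite big_map; split=> //.
move=> y /mapP[h _ ->].
by split; [exact: hp|exists h => //; exact: gproj_part].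
Qed.

Lemma ridealP N : @gr_submodule G R (regular R) N <-> rideal N.
Proof.
by split=> -[h1 h2 h3]; split=> //; exact/(graded_gproj h1).
Qed.

Lemma rideal0 N : rideal N -> N 0. Proof. by move=> [[]]. Qed.

Lemma ridealB N x y : rideal N -> N x -> N y -> N (x - y).
Proof. by move=> [[_ h] _ _]; exact: h. Qed.

Lemma ridealD N x y : rideal N -> N x -> N y -> N (x + y).
Proof. by move=> [h _ _]; exact: additive_subgroupD. Qed.

Lemma ridealM N x a : rideal N -> N x -> N (x ** a).
Proof. by move=> [_ h _]; exact: h. Qed.

Lemma rideal_gproj N g x : rideal N -> N x -> N (gproj g x).
Proof. by move=> [_ _ h]; exact: h. Qed.

Definition limage a S : set R := [set y | exists2 x, S x & y = a ** x].

Lemma rideal_limage g a S : gpart g a -> rideal S -> rideal (limage a S).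
Proof.
move=> ag hS; split.
- split; first by exists 0; rewrite ?gmulr0//; exact: rideal0.
  move=> _ _ [x Sx ->] [y Sy ->]; exists (x - y); first exact: ridealB.
  by rewrite gmulBr.
- move=> _ b [x Sx ->]; exists (x ** b); last by rewrite gmulA.
  exact: ridealM.
- move=> k _ [x Sx ->]; have [->|/eqP n0] := eqVneq (gproj k (a ** x)) 0.
    by exists 0; rewrite ?gmulr0//; exact: rideal0.
  have [h [_ _ ->]] := gproj_mull_cases ag n0.
  by exists (gproj h x) => //; exact: rideal_gproj.
Qed.

Lemma ridealT : rideal setT. Proof. by []. Qed.

Lemma principal_self g a : gpart g a -> limage a setT a.
Proof. by move=> ag; exists (gone R (gdom g)) => //; rewrite (gmul_one ag). Qed.

(** The right ideal generated by a homogeneous element is graded; hence gr-simplicity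
    can be tested on generators, which avoids quantifying over submodules. *)
Definition rsimple N := [/\ rideal N, exists2 x, N x & x <> 0
  & forall g x y, gpart g x -> N x -> x <> 0 -> N y -> exists a, y = x ** a].

Lemma rsimpleP N : @gr_simple_submodule G R (regular R) N <-> rsimple N.
Proof.
split.
  move=> [/ridealP hN N0 hs]; split=> //.
    apply: contrapT => h; apply: N0; apply/seteqP; split=> x /=.
      by move=> Nx; apply: contrapT => x0; apply: h; exists x.
    by move=> ->; exact: rideal0.
  move=> g x y xg Nx x0 Ny.
  have hx := rideal_limage xg ridealT.
  have xN : limage x setT `<=` N by move=> _ [a _ ->]; exact: ridealM.
  have [E|E] := hs _ (proj2 (ridealP _) hx) xN.
    by have := principal_self xg; rewrite E => /x0.
  by move: Ny; rewrite -E => -[a _ ->]; exists a.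
move=> [hN [x0 Nx0 x00] hs]; split; first exact/ridealP.
  by move=> E; move: Nx0; rewrite E.
move=> N' /ridealP hN' N'N; have [h|h] := pselect (exists2 x, N' x & x <> 0).
  right; apply/seteqP; split=> // y Ny.
  have [x N'x /gproj_neq0[g xg]] := h.
  have N'g := rideal_gproj g hN' N'x.
  have [a ->] := hs g _ y (gproj_part g x) (N'N _ N'g) xg Ny.
  exact: ridealM.
left; apply/seteqP; split=> x /=; last by move=> ->; exact: rideal0.
by move=> N'x; apply: contrapT => xn0; apply: h; exists x.
Qed.

(** The image of a gr-simple right ideal [S] under left multiplication by [a] is
    again gr-simple when it is nonzero: a nonzero homogeneous [a z] comes from a
    nonzero homogeneous [z] of [S], and [z] generates [S]. *)
Lemma rsimple_limage g a S : gpart g a -> rsimple S ->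
  (exists2 x, S x & a ** x <> 0) -> rsimple (limage a S).
Proof.
move=> ag [hS _ sS] [x Sx ax]; split; first exact: rideal_limage ag hS.
  by exists (a ** x) => //; exists x.
move=> k x0 y0 zk [z Sz x0E]; rewrite {}x0E in zk *; move=> az0 [y Sy ->] {y0}.
have [h [_ _ E]] := hom_quotient ag zk erefl az0.
have z0 : gproj h z <> 0 by move=> z0; apply: az0; rewrite E z0 gmulr0.
have [b ->] := sS h _ y (gproj_part h z) (rideal_gproj h hS Sz) z0 Sy.
by exists b; rewrite E gmulA.
Qed.

Definition simple_union : set R := \bigcup_(N in [set N | rsimple N]) N.

Lemma gr_semisimpleP : gr_semisimple R <-> fin_sums simple_union = setT.
Proof.
suff E : \bigcup_(N in [set N | @gr_simple_submodule G R (regular R) N]) N =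
   simple_union by rewrite /gr_semisimple /gr_semisimple_module E.
by apply/seteqP; split=> x [N /rsimpleP hN Nx]; exists N.
Qed.

Definition rsum T S : set R := [set x | exists t s, [/\ T t, S s & x = t + s]].

Lemma rideal_rsum T S : rideal T -> rideal S -> rideal (rsum T S).
Proof.
move=> hT hS; split.
- split; first by exists 0, 0; split; rewrite ?addr0//; exact: rideal0.
  move=> _ _ [t [s [Tt Ss ->]]] [t' [s' [Tt' Ss' ->]]].
  exists (t - t'), (s - s'); split; try exact: ridealB.
  by rewrite opprD addrACA.
- move=> _ a [t [s [Tt Ss ->]]]; exists (t ** a), (s ** a).
  by split; try exact: ridealM; rewrite gmulDl.
- move=> g _ [t [s [Tt Ss ->]]]; exists (gproj g t), (gproj g s).
  by split; try exact: rideal_gproj; rewrite gprojD.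
Qed.

Definition dcc_below T := forall N : nat -> set R, (forall n, rideal (N n)) ->
  (forall n, N n `<=` T) -> (forall n, N n.+1 `<=` N n) ->
  exists n, forall m, (n <= m)%N -> N m = N n.

Lemma decreasing_le (N : nat -> set R) n m :
  (forall n, N n.+1 `<=` N n) -> (n <= m)%N -> N m `<=` N n.
Proof.
move=> dN; elim: m => [|m IH]; first by rewrite leqn0 => /eqP->.
by rewrite leq_eqVlt => /orP[/eqP->//|/IH h] x /dN/h.
Qed.

(** Adding a gr-simple right ideal [S] to [T] preserves the descending chain
    condition: the trace of a chain on [T] stabilizes, and either the chain
    eventually lies in [T], or each of its members has the same image in
    [(T + S) / T]. *)
Lemma dcc_below_rsum T S : rideal T -> rsimple S -> dcc_below T -> dcc_below (rsum T S).
Proof.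
move=> hT [hS _ sS] aT N hN NT dN.
have [n0 st] : exists n, forall m, (n <= m)%N -> N m `&` T = N n `&` T.
  apply: (aT (fun n => N n `&` T)).
  - move=> n; split.
    + split; first by split; exact: rideal0.
      by move=> x y [? ?] [? ?]; split; exact: ridealB.
    + by move=> x a [? ?]; split; exact: ridealM.
    + by move=> g x [? ?]; split; exact: rideal_gproj.
  - by move=> n x [].
  - by move=> n x [/dN].
(* [A n] says that [N n] covers the quotient of [T + S] by [T]. *)
pose A n := forall s, S s -> exists2 t, T t & N n (s + t).
have [hA|/existsNP[n1 nA]] := pselect (forall n, A n).
  exists n0 => m nm; apply/seteqP; split; first exact: decreasing_le.
  move=> x Nx; have [t [s [Tt Ss xts]]] := NT _ _ Nx.
  have [t' Tt' Nm] := hA m s Ss.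
  have : (N n0 `&` T) (x - (s + t')).
    split; first by apply: ridealB => //; exact: (decreasing_le dN nm).
    by rewrite xts opprD addrACA addrA subrK; exact: ridealB.
  rewrite -(st m nm) => -[Nmx _].
  by rewrite -[x](subrK (s + t')); exact: ridealD.
have NT1 : N n1 `<=` T.
  move=> x Nx; have [t [s [Tt Ss xts]]] := NT _ _ Nx.
  suff s0 : s = 0 by rewrite xts s0 addr0.
  apply: contrapT => /gproj_neq0[g sg]; apply: nA => s' Ss'.
  have [b s'b] := sS g _ s' (gproj_part g s) (rideal_gproj g hS Ss) sg Ss'.
  exists (gproj g t ** b); first by apply: ridealM => //; exact: rideal_gproj.
  rewrite s'b -gmulDl addrC -gprojD -xts; apply: ridealM => //.
  exact: rideal_gproj.
exists (maxn n0 n1) => m; rewrite geq_max => /andP[m0 m1].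
have NI n : (n1 <= n)%N -> N n = N n `&` T.
  move=> n1n; apply/seteqP; split=> [x Nx|x []//]; split=> //.
  exact/NT1/(decreasing_le dN n1n).
by rewrite NI // (NI (maxn n0 n1)) ?leq_maxr // !st // leq_maxl.
Qed.

End RightIdeals.

Arguments simple_union {G} R.

(** * Minimal idempotents *)

Section Frames.
Variables (G : groupoid) (R : gring G).
Implicit Types (g h k : G) (x y z a b p q : R) (e f : gobj G) (N S T I : set R).

(** Among idempotents of degree [gid e], those for which [p R] is gr-simple, in a
    form that mentions homogeneous elements only. *)
Definition min_idem e p := [/\ gpart (gid e) p, p <> 0, p ** p = p
  & forall g x, gpart g x -> p ** x = x -> x <> 0 ->
      exists h y, gpart h y /\ x ** y = p].

Lemma min_idem_rng e p g x : min_idem e p -> gpart g x -> p ** x <> 0 -> grng g = e.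
Proof.
by move=> [pe _ _ _] xg px; have := hom_mul_neq0 pe xg px; rewrite gdom_id.
Qed.

Lemma min_idem_dom e p g x : min_idem e p -> gpart g x -> x ** p <> 0 -> gdom g = e.
Proof.
by move=> [pe _ _ _] xg px; have := hom_mul_neq0 xg pe px; rewrite grng_id.
Qed.

Lemma rsimple_min_idem e p : min_idem e p -> rsimple (limage p setT).
Proof.
move=> [pe p0 pp pmin]; split; first exact: rideal_limage pe (ridealT R).
  by exists p => //; exists p.
move=> g x y xg [x' _ xE] x0 [y' _ ->].
have px : p ** x = x by rewrite xE gmulA pp.
have [h [z [_ xz]]] := pmin g x xg px x0.
by exists (z ** y'); rewrite gmulA xz.
Qed.

(** What matrix rings owe to their diagonal idempotents: each [1_e R] is a finite sum
    of gr-simple right ideals [p R]. This gives the chain condition, and gr-simplicity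
    too if the idempotents in [P] are linked by nonzero homogeneous elements. *)
Definition framed (P : set R) := forall e, exists L : seq R,
  (forall p, p \in L -> P p /\ min_idem e p) /\ gone R e = \sum_(p <- L) p.

(** The right ideal [1_e R] is a finite sum of gr-simple ones [p R], which are
    added one at a time. *)
Lemma framed_artinian P : framed P -> obj_artinian R.
Proof.
move=> fP e; have [L [hL eL]] := fP e.
have [T [hT aT TL]] : exists T, [/\ rideal T, dcc_below T
    & forall p x, p \in L -> T (p ** x)].
  elim: L hL {eL} => [|p L IH] hL.
    exists [set 0]; split=> //.
    - split; first by split=> // x y -> ->; rewrite /= subr0.
        by move=> x a ->; exact: gmul0r.
      by move=> g x ->; exact: gproj0.
    - move=> N hN NT _; exists 0%N => m _; apply/seteqP; split=> x /NT ->;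
      exact: rideal0.
  have [|T [hT aT TL]] := IH; first by move=> q qL; apply: hL; rewrite inE qL orbT.
  have [_ mp] := hL p (mem_head _ _); have sp := rsimple_min_idem mp.
  have rp : rideal (limage p setT) by have [] := sp.
  exists (rsum T (limage p setT)); split.
  - exact: rideal_rsum.
  - exact: dcc_below_rsum.
  move=> q x; rewrite inE => /orP[/eqP->|/(TL _ x) Tq].
    by exists 0, (p ** x); rewrite add0r; split=> //; [exact: rideal0|exists x].
  by exists (q ** x), 0; rewrite addr0; split=> //; exact: rideal0.
move=> N hN NT dN; apply: aT => //; first by move=> n; apply/ridealP.
move=> n x /NT[a ->]; rewrite eL gmul_suml.
by apply: subgroup_sum => [|p pL]; [have [] := hT|exact: TL].
Qed.

Lemma gr_ideal_gproj I g x : gr_ideal I -> I x -> I (gproj g x).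
Proof. by move=> [h1 _ _ /(graded_gproj h1)]; apply. Qed.

Lemma gr_ideal_hom I : gr_ideal I -> I <> [set 0] ->
  exists g x, [/\ gpart g x, I x & x <> 0].
Proof.
move=> hI In0; have [x [Ix x0]] : exists x, I x /\ x <> 0.
  apply: contrapT => h; apply: In0; apply/seteqP; split=> x /=.
    by move=> Ix; apply: contrapT => x0; apply: h; exists x.
  by move=> ->; have [[]] := hI.
have [g xg] := gproj_neq0 x0.
by exists g, (gproj g x); split=> //; [exact: gproj_part|exact: gr_ideal_gproj].
Qed.

Lemma gr_ideal_full I : gr_ideal I -> (forall e, I (gone R e)) -> I = setT.
Proof.
move=> [hI hM _ _] h1; apply/seteqP; split=> // x _.
elim/homog_ind: x => [|g x xg|x y]; first by have [] := hI.
  by rewrite -(gone_mul xg); exact: hM.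
exact: additive_subgroupD.
Qed.

(** A nonzero graded ideal contains some nonzero [p x] with [p] in [P], hence [p],
    as [p] is minimal. For another [q] in [P], a nonzero homogeneous [w] of [q R p]
    lies in the ideal, and [q] is a right multiple of [w]. *)
Lemma framed_simple P : framed P -> [set: R] <> [set 0] ->
  (forall p q, P p -> P q -> exists g w, [/\ gpart g w, w <> 0, p ** w = w
    & w ** q = w]) -> gr_simple R.
Proof.
move=> fP R0 cP; split=> // I hI; have [->|/eqP I0] := eqVneq I [set 0]; first by left.
have [_ IM MI _] := hI.
right; apply: gr_ideal_full => // e; have [L [hL ->]] := fP e.
apply: subgroup_sum; first by have [] := hI.
move=> q qL; have [Pq [_ _ _ qmin]] := hL q qL.
have [g [x [xg Ix x0]]] := gr_ideal_hom hI I0.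
have [L' [hL' eL']] := fP (grng g).
have : \sum_(p <- L') p ** x <> 0 by rewrite -gmul_suml -eL' (gone_mul xg).
move=> /sum_neq0[p pL' px].
have [Pp mp] := hL' p pL'; have [pe p0 pp pmin] := mp.
have pg : gdom (gid (grng g)) = grng g by rewrite gdom_id.
have [h [y [_ xy]]] := pmin _ _ (gpart_mul pe xg pg) (etrans (gmulA _ _ _)
  (congr1 (fun z => z ** x) pp)) px.
have Ip : I p by rewrite -xy; apply: IM; exact: MI.
have [k [w [wk w0 qw wp]]] := cP q p Pq Pp.
have [l [z [_ wz]]] := qmin k w wk qw w0.
by rewrite -wz -wp; apply: IM; exact: MI.
Qed.

(** The generating set consists of homogeneous elements, hence an ideal it spans
    is graded as soon as it is stable under homogeneous multiplications. *)
Lemma gr_ideal_gen (A : set R) : A `<=` homogeneous (@gpart G R) ->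
  (forall x, A x -> A (- x)) ->
  (forall x g a, A x -> gpart g a -> A (x ** a)) ->
  (forall x g a, A x -> gpart g a -> A (a ** x)) -> gr_ideal (fin_sums A).
Proof.
move=> Ahom AN Ar Al; split.
- split; first exact: fin_sums0.
  by move=> x y hx hy; apply: fin_sumsD => //; exact: fin_sumsN.
- move=> x a; elim/homog_ind: a => [|g a ag|a b ha hb hx].
  + by rewrite gmulr0 => _; exact: fin_sums0.
  + elim/fin_sums_ind => [|y z Ay _]; first by rewrite gmul0r; exact: fin_sums0.
    by rewrite gmulDl; apply: fin_sumsD; apply: fin_sums1; exact: Ar ag.
  + by rewrite gmulDr; apply: fin_sumsD; [exact: ha|exact: hb].
- move=> x a; elim/homog_ind: a => [|g a ag|a b ha hb hx].
  + by rewrite gmul0r => _; exact: fin_sums0.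
  + elim/fin_sums_ind => [|y z Ay _]; first by rewrite gmulr0; exact: fin_sums0.
    by rewrite gmulDr; apply: fin_sumsD; apply: fin_sums1; exact: Al ag.
  + by rewrite gmulDl; apply: fin_sumsD; [exact: ha|exact: hb].
- move=> x [s [hs ->]]; exists s; split=> // y ys.
  by split; [apply: fin_sums1; exact: hs|apply: Ahom; exact: hs].
Qed.

(** * Gr-simple artinian rings *)

(** If no gr-simple right ideal existed, every nonzero graded right ideal in [1_e R]
    would contain a strictly smaller nonzero one, generated by a homogeneous
    element, and an infinite descending chain could be chosen. *)
Lemma artinian_rsimple e N : obj_artinian R -> rideal N -> N `<=` obj_part R e ->
  (exists2 x, N x & x <> 0) -> exists S : set R, rsimple S.
Proof.
move=> aR hN Ne Nn0; apply: contrapT => noS.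
pose good S := [/\ rideal S, S `<=` obj_part R e & exists2 x, S x & x <> 0].
have step (S : {S | good S}) : exists S' : {S | good S},
    sval S' `<=` sval S /\ sval S' <> sval S.
  case: S => S hS /=; have [rS Se [x0 Sx0 x00]] := hS.
  have [g [x [y [xg Sx xn0 Sy nxy]]]] :
      exists g x y, [/\ gpart g x, S x, x <> 0, S y & ~ exists a, y = x ** a].
    apply: contrapT => h; apply: noS; exists S; split=> //; first by exists x0.
    move=> g x y xg Sx x0' Sy; apply: contrapT => nxy; apply: h.
    by exists g, x, y.
  have xS : limage x setT `<=` S by move=> _ [a _ ->]; exact: ridealM.
  have gx : good (limage x setT).
    split; first exact: rideal_limage xg (ridealT R).
      by move=> z /xS/Se.
    by exists x => //; exact: principal_self xg.
  exists (exist _ _ gx); split=> //= E.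
  have [a _ yxa] : limage x setT y by rewrite E.
  by apply: nxy; exists a.
pose next (S : {S | good S}) := projT1 (cid (step S)).
pose c n := iter n next (exist good N (And3 hN Ne Nn0)).
have cS n : sval (c n.+1) `<=` sval (c n) /\ sval (c n.+1) <> sval (c n).
  by rewrite /c iterS /next; case: cid.
have [||| n st] := aR e (fun n => sval (c n)).
- by move=> n; apply/ridealP; have [] := svalP (c n).
- by move=> n; have [] := svalP (c n).
- by move=> n; have [] := cS n.
- by have [_] := cS n; apply; exact: st.
Qed.

(** The sum of all gr-simple right ideals is stable under left multiplications,
    since these carry a gr-simple right ideal to zero or to a gr-simple one. It is
    therefore a graded two-sided ideal, nonzero by the chain condition. *)
Lemma simple_artinian_semisimple : gr_simple R -> obj_artinian R ->
  fin_sums (simple_union R) = setT.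
Proof.
move=> [R0 sR] aR.
pose A : set R := simple_union R `&` homogeneous (@gpart G R).
have AE : fin_sums A `<=` fin_sums (simple_union R).
  by move=> x [s [hs ->]]; exists s; split=> // y /hs[].
have [e e0] : exists e, gone R e <> 0.
  apply: contrapT => h; apply: R0; apply/seteqP; split=> // x _ /=.
  elim/homog_ind: x => // [g x xg|x y -> ->]; last exact: addr0.
  rewrite -(gone_mul xg); have -> : gone R (grng g) = 0; last exact: gmul0r.
  by apply: contrapT => h'; apply: h; exists (grng g).
have [S hS] : exists S : set R, rsimple S.
  apply: (@artinian_rsimple e (limage (gone R e) setT)) => //.
  - exact: rideal_limage (gone_part R e) (ridealT R).
  - by move=> _ [a _ ->]; exists a.
  - by exists (gone R e) => //; exact: principal_self (gone_part R e).
have [rS [x0 Sx0 /gproj_neq0[g0 xg0]] _] := hS.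
have : gr_ideal (fin_sums A).
  apply: gr_ideal_gen.
  - by move=> x [].
  - move=> x [[N hN Nx] [g _ xg]]; split; last by exists g => //; exact: gpartN.
    by exists N => //; apply: additive_subgroupN Nx; have [[]] := hN.
  - move=> x g a [[N hN Nx] [h _ xh]] ag; split; last exact: gpart_hom_mul xh ag.
    by exists N => //; apply: ridealM => //; have [] := hN.
  - move=> x g a [[N hN Nx] [h _ xh]] ag; split; last exact: gpart_hom_mul ag xh.
    have [ax|/eqP ax] := eqVneq (a ** x) 0.
      by rewrite ax; exists N => //; apply: rideal0; have [] := hN.
    exists (limage a N); last by exists x.
    by apply: rsimple_limage ag hN _; exists x.
move=> /sR[E|E]; last by apply/seteqP; split=> // x _; apply: AE; rewrite E.
case: xg0; suff : fin_sums A (gproj g0 x0) by rewrite E.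
apply: fin_sums1; split; last by exists g0 => //; exact: gproj_part.
by exists S => //; exact: rideal_gproj.
Qed.

End Frames.

(** * Graded homomorphisms and graded products *)

Section Morphisms.
Variable G : groupoid.
Implicit Types R S : gring G.

Definition additive_graded R S (f : R -> S) :=
  {morph f : x y / x + y} /\ forall g x, gpart g x -> gpart g (f x).

Lemma additive_map0 (V W : zmodType) (f : V -> W) :
  {morph f : x y / x + y} -> f 0 = 0.
Proof. by move=> fD; apply: (addIr (f 0)); rewrite -fD !add0r. Qed.

Lemma gproj_morph R S (f : R -> S) g x : additive_graded f ->
  gproj g (f x) = f (gproj g x).
Proof.
move=> [fD fg]; have f0 := additive_map0 fD.
elim/homog_ind: x => [|h x xh|x y IHx IHy].
- by rewrite f0 !gproj0.
- have [hg|hg] := pselect (h = g).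
    by rewrite -hg (gproj_id xh) gproj_id //; exact: fg.
  by rewrite (gproj_off xh hg) f0; apply: gproj_off hg; exact: fg.
- by rewrite fD !gprojD IHx IHy fD.
Qed.

(** A graded additive map commutes with taking components, so injectivity and
    surjectivity, like multiplicativity, are decided on homogeneous elements. *)
Lemma gr_iso_of_components R S (f : R -> S) : additive_graded f ->
  (forall g h x y, gpart g x -> gpart h y -> f (x ** y) = f x ** f y) ->
  (forall g x, gpart g x -> f x = 0 -> x = 0) ->
  (forall g y, gpart g y -> exists2 x, gpart g x & f x = y) -> gr_iso R S.
Proof.
move=> af fM finj fsurj; have [fD fg] := af; have f0 := additive_map0 fD.
have finj' : injective f.
  move=> x y fxy; apply/eqP; rewrite -subr_eq0; apply/eqP; apply: contrapT.
  move=> /gproj_neq0[g]; apply; apply: finj (gproj_part _ _) _.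
  rewrite -(gproj_morph _ _ af); have -> : f (x - y) = 0; last exact: gproj0.
  by apply: (addIr (f y)); rewrite -fD subrK fxy add0r.
have fsurj' y : exists x, f x = y.
  elim/homog_ind: y => [|g y /fsurj[x _ <-]|_ _ [x <-] [y <-]].
  - by exists 0.
  - by exists x.
  - by exists (x + y); rewrite fD.
have fK : cancel (fun y => projT1 (cid (fsurj' y))) f by move=> y; case: cid.
exists f; split=> //.
  by exists (fun y => projT1 (cid (fsurj' y))) => // x; exact: finj'.
move=> x y; elim/homog_ind: x => [|g x xg|x x' IH IH'].
- by rewrite gmul0r f0 gmul0r.
- elim/homog_ind: y => [|h y yh|y y' IH IH'].
  + by rewrite gmulr0 f0 gmulr0.
  + exact: fM xg yh.
  + by rewrite gmulDr !fD gmulDr IH IH'.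
- by rewrite gmulDl !fD gmulDl IH IH'.
Qed.

(** Gr-simple right ideals are pulled back along the isomorphism. *)
Lemma semisimple_iso R S : gr_iso R S -> fin_sums (simple_union S) = setT ->
  fin_sums (simple_union R) = setT.
Proof.
move=> [f [[f' fK f'K] fD fM fg]] sS; have f0 := additive_map0 fD.
have f'D : {morph f' : x y / x + y}.
  by move=> x y; apply: (can_inj fK); rewrite fD !f'K.
apply/seteqP; split=> // x _; rewrite -[x]fK.
have : fin_sums (simple_union S) (f x) by rewrite sS.
elim/fin_sums_ind => [|y z [N [rN [y0 Ny0 y00] sN] Ny] _ IH].
  by rewrite (additive_map0 f'D); exact: fin_sums0.
rewrite f'D; apply: fin_sumsD => //; apply: fin_sums1.
exists [set u | N (f u)]; last by rewrite /= f'K.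
split.
- split.
  + split; first by rewrite /= f0; exact: rideal0.
    move=> u v Nu Nv /=; have -> : f (u - v) = f u - f v.
      by apply: (addIr (f v)); rewrite -fD !subrK.
    exact: ridealB.
  + by move=> u a Nu; rewrite /= fM; exact: ridealM.
  + by move=> g u Nu; rewrite /= -gproj_morph//; exact: rideal_gproj.
- exists (f' y0); rewrite /= ?f'K// => /(congr1 f).
  by rewrite f'K f0.
- move=> g u v ug Nu u0 Nv; have [|b fvb] := sN g (f u) (f v) (fg _ _ ug) Nu _ Nv.
    by rewrite -f0 => /(can_inj fK).
  by exists (f' b); apply: (can_inj fK); rewrite fM f'K.
Qed.

Section Lift.
Variables (R : gring G) (H : hsystem G) (F : R -> hs_amb H).
Hypotheses (FD : {morph F : x y / x + y})
  (Fg : forall g x, gpart g x -> hs_part g (F x)).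

Lemma lift_sums x : hs_sums (F x).
Proof.
elim/homog_ind: x => [|g x /Fg|x y hx hy].
- by rewrite (additive_map0 FD); exact: fin_sums0.
- exact: hs_part_sums.
- by rewrite FD; exact: fin_sumsD.
Qed.

(** The ring of a system consists of the sums of homogeneous elements, and the
    image of a graded additive map always lies there. *)
Definition hs_lift x : gring_of H := HsRing (introT (hs_predP _) (lift_sums x)).

Lemma additive_graded_lift : additive_graded hs_lift.
Proof. by split=> [x y|g x /Fg//]; apply: val_inj; exact: FD. Qed.

End Lift.

End Morphisms.

Section Products.
Variables (G : groupoid) (J : Type).

(** The family with [x] at [j] and zero elsewhere; [x] is transported along the
    equality of indices, as the groups [V i] are different types. *)
Definition dsingle (V : J -> zmodType) j (x : V j) : dprod V := fun i =>
  if pselect (j = i) is left e then eq_rect j (fun i => V i : Type) x i e else 0.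

Lemma dsingle_eq (V : J -> zmodType) j (x : V j) : dsingle x j = x.
Proof.
rewrite /dsingle; case: pselect => // e.
by rewrite (Prop_irrelevance e erefl).
Qed.

Lemma dsingle_neq (V : J -> zmodType) j (x : V j) i : j <> i -> dsingle x i = 0.
Proof. by rewrite /dsingle; case: pselect. Qed.

Lemma dsingle_sum (V : J -> zmodType) (s : seq {classic J}) (y : dprod V) :
  uniq s -> (forall j : {classic J}, y j <> 0 -> j \in s) ->
  y = \sum_(j <- s) dsingle (y j).
Proof.
move=> us ys; apply: functional_extensionality_dep => j; rewrite dprod_sumE.
pose j' : {classic J} := j.
have [js|js] := boolP (j' \in s).
  rewrite (bigD1_seq j') //= dsingle_eq big1 ?addr0 // => i /eqP ij.
  exact: dsingle_neq.
rewrite big_seq big1 ?addr0 => [|i is_]; last first.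
  by apply: dsingle_neq => ij; rewrite ij in is_; rewrite is_ in js.
by apply: contrapT => /(ys j'); rewrite (negPf js).
Qed.

Variable Q : J -> gring G.

Lemma dsingleD j : {morph @dsingle Q j : x y / x + y}.
Proof.
move=> x y; apply: functional_extensionality_dep => i.
change (@dsingle Q j (x + y) i = @dsingle Q j x i + @dsingle Q j y i).
have [<-|ji] := pselect (j = i); first by rewrite !dsingle_eq.
by rewrite !dsingle_neq ?addr0.
Qed.

Lemma dsingle_part j g (x : Q j) : gpart g x -> prod_part g (@dsingle Q j x).
Proof.
move=> xg i; have [<-|ji] := pselect (j = i); first by rewrite dsingle_eq.
by rewrite dsingle_neq //; exact: gpart_zero.
Qed.

Definition prod_inj j : Q j -> gr_prod Q :=
  @hs_lift G (Q j) (prod_hsystem Q) (@dsingle Q j) (@dsingleD j) (@dsingle_part j).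

Lemma prod_injM j (x : Q j) (y : gr_prod Q) :
  prod_inj x ** y = prod_inj (x ** hs_val y j).
Proof.
apply: val_inj; apply: functional_extensionality_dep => i.
change (@dsingle Q j x i ** hs_val y i = @dsingle Q j (x ** hs_val y j) i).
have [<-|ji] := pselect (j = i); first by rewrite !dsingle_eq.
by rewrite !dsingle_neq // gmul0r.
Qed.

Lemma prod_inj_inj j : injective (@prod_inj j).
Proof.
move=> x y /(congr1 (fun z : gr_prod Q => hs_val z j)).
by rewrite /= !dsingle_eq.
Qed.

(** An element of the product acts on a factor through its coordinate there, so
    the factor has the same graded right ideals over itself and over the product. *)
Lemma rsimple_prod_inj j (S : set (Q j)) : rsimple S -> rsimple (@prod_inj j @` S).
Proof.
have aI : additive_graded (@prod_inj j) by exact: additive_graded_lift.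
have [ID _] := aI; have I0 := additive_map0 ID.
move=> [rS [x0 Sx0 x00] sS]; split.
- split.
  + split; first by exists 0 => //; exact: rideal0.
    move=> _ _ [x Sx <-] [y Sy <-]; exists (x - y); first exact: ridealB.
    by apply: (addIr (prod_inj y)); rewrite -ID !subrK.
  + move=> _ y [x Sx <-]; rewrite prod_injM; eexists; last by [].
    exact: ridealM.
  + move=> g _ [x Sx <-]; rewrite (gproj_morph _ _ aI); eexists; last by [].
    exact: rideal_gproj.
- exists (prod_inj x0); first by exists x0.
  by rewrite -I0 => /prod_inj_inj.
- move=> g x y xg [x' Sx' Ex] x0' [y' Sy' <-].
  have x'g : gpart g x' by have := xg j; rewrite -Ex /= dsingle_eq.
  have [|b ->] := sS g x' y' x'g Sx' _ Sy'.
    by move=> x'0; apply: x0'; rewrite -Ex x'0.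
  exists (prod_inj b); rewrite -Ex prod_injM; congr prod_inj.
  by rewrite /= dsingle_eq.
Qed.

(** By summability an element of the product is a finite sum of elements of the
    factors. *)
Lemma semisimple_prod : summable Q ->
  (forall j, fin_sums (simple_union (Q j)) = setT) ->
  fin_sums (simple_union (gr_prod Q)) = setT.
Proof.
move=> sQ ssQ; apply/seteqP; split=> // x _.
have : hs_sums (hs_val x) by exact: hs_ringS.
rewrite /hs_sums /= sQ => /(@finite_seqP {classic J})[s hs].
have -> : x = \sum_(j <- undup s) prod_inj (hs_val x j).
  apply: val_inj; rewrite (big_morph val (id1 := 0) (op1 := +%R)) //=.
  apply: dsingle_sum; first exact: undup_uniq.
  by move=> j xj; rewrite mem_undup; have : [set` s] j by rewrite -hs.
elim: (undup s) => [|j t IH]; first by rewrite big_nil; exact: fin_sums0.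
rewrite big_cons; apply: fin_sumsD => {t IH} //.
have [ID _] : additive_graded (@prod_inj j) by exact: additive_graded_lift.
have : fin_sums (simple_union (Q j)) (hs_val x j) by rewrite ssQ.
elim/fin_sums_ind => [|y z [N hN Ny] _].
  by rewrite (additive_map0 ID); exact: fin_sums0.
rewrite ID; apply: fin_sumsD; apply: fin_sums1.
by exists (@prod_inj j @` N); [exact: rsimple_prod_inj|exists y].
Qed.

Lemma semisimple_of_simple_artinian_factors (R : gring G) :
  (forall j, gr_simple (Q j) /\ obj_artinian (Q j)) -> summable Q ->
  gr_iso R (gr_prod Q) -> gr_semisimple R.
Proof.
move=> hQ sQ iR; apply/gr_semisimpleP; apply: semisimple_iso iR _.
apply: semisimple_prod => // j; have [? ?] := hQ j.
exact: simple_artinian_semisimple.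
Qed.

End Products.

(** * Graded division rings over one object *)

Section OneObject.
Variables (G : groupoid) (D : gring G) (e : gobj G).
Hypotheses (hD : gr_division D) (suppD : supp D `<=` ghom e e).

(** A nonzero homogeneous element of the ideal is invertible, and its inverse
    yields the identity of the only object in the support. *)
Lemma division_ideal_one I : @gr_ideal G D I -> I <> [set 0] -> I (gone D e).
Proof.
move=> hI /(gr_ideal_hom hI)[g [x [xg Ix x0]]]; have [_ inv] := hD.
have [b [_ xb _]] := inv g x xg x0.
have [<- _] : ghom e e g by apply: suppD; exists x.
by rewrite -xb; have [_ IM _ _] := hI; exact: IM.
Qed.

Lemma division_prime : gr_prime D.
Proof.
move=> I J hI hJ I0 J0 IJ; apply: (obj_supp_division hD suppD).
suff : ideal_mul I J (gone D e) by rewrite IJ.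
apply: fin_sums1; exists (gone D e), (gone D e).
by rewrite gone_idem; split=> //; exact: division_ideal_one.
Qed.

End OneObject.

(** * Matrix rings over gr-prime graded division rings *)

Section PrimeConnected.
Variables (G : groupoid) (D : gring G).

(** These generators of the ideal [D 1_e D] are chosen homogeneous, so that the ideal
    they span is visibly graded. *)
Definition obj_ideal_gens (e : gobj G) : set D := [set x | exists g h a b,
  [/\ gpart g a, gpart h b & x = a ** gone D e ** b]].

Lemma gr_ideal_obj e : gr_ideal (fin_sums (obj_ideal_gens e)).
Proof.
have hom3 g h a b : gpart g a -> gpart h b ->
    homogeneous (@gpart G D) (a ** gone D e ** b).
  move=> ag bh; have [k _ ck] := gpart_hom_mul ag (gone_part D e).
  exact: gpart_hom_mul ck bh.
apply: gr_ideal_gen.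
- by move=> _ [g [h [a [b [ag bh ->]]]]]; exact: hom3 ag bh.
- move=> _ [g [h [a [b [ag bh ->]]]]]; exists g, h, a, (- b).
  split=> //; first exact: gpartN.
  by rewrite -[- b]sub0r gmulBr gmulr0 sub0r.
- move=> _ k c [g [h [a [b [ag bh ->]]]]] ck.
  have [l _ bc] := gpart_hom_mul bh ck.
  by exists g, l, a, (b ** c); rewrite !gmulA.
- move=> _ k c [g [h [a [b [ag bh ->]]]]] ck.
  have [l _ ca] := gpart_hom_mul ck ag.
  by exists l, h, (c ** a), b; rewrite !gmulA.
Qed.

Lemma obj_ideal_neq0 e : obj_supp D e -> fin_sums (obj_ideal_gens e) <> [set 0].
Proof.
move=> e0 E; apply: e0; rewrite -[_ = _]/([set 0] (gone D e)) -E.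
apply: fin_sums1; exists (gid e), (gid e), (gone D e), (gone D e).
by rewrite !gone_idem; split=> //; exact: gone_part.
Qed.

(** If the component [1_e D 1_f] were zero, the nonzero ideals generated by [1_e]
    and [1_f] would have product zero. *)
Lemma prime_connected e f : gr_prime D -> obj_supp D e -> obj_supp D f ->
  exists h u, [/\ gpart h u, u <> 0 :> D, grng h = e & gdom h = f].
Proof.
move=> pD e0 f0; apply: contrapT => nh.
have z0 (z : D) : gone D e ** z ** gone D f = 0.
  elim/homog_ind: z => [|h u uh|x y hx hy]; first by rewrite gmulr0 gmul0r.
    apply: contrapT => n0; apply: nh; exists h, u; split=> //.
    - by move=> u0; apply: n0; rewrite u0 gmulr0 gmul0r.
    - apply: contrapT => he; apply: n0; rewrite (gone_mul_neq uh) ?gmul0r//.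
      by move=> E; apply: he.
    - apply: contrapT => hf; apply: n0; rewrite -gmulA.
      rewrite (gpart_mul0 uh (gone_part D f)) ?gmulr0//.
      by rewrite grng_id.
  by rewrite gmulDr gmulDl hx hy addr0.
apply: (pD _ _ (gr_ideal_obj e) (gr_ideal_obj f));
  [exact: obj_ideal_neq0|exact: obj_ideal_neq0|].
have xy0 x y : fin_sums (obj_ideal_gens e) x -> fin_sums (obj_ideal_gens f) y ->
    x ** y = 0.
  elim/fin_sums_ind => [|x1 x2 [g [h [a [b [_ _ ->]]]]] _ IH] hy.
    exact: gmul0r.
  rewrite gmulDl {}IH // addr0; move: hy.
  elim/fin_sums_ind => [|y1 y2 [g' [h' [a' [b' [_ _ ->]]]]] _ IH].
    exact: gmulr0.
  rewrite gmulDr {}IH // addr0.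
  by rewrite -!gmulA !(gmulA (gone D e)) !gmulA -(gmulA a) -(gmulA a _ a')
    -(gmulA (gone D e)) -(gmulA a) z0 gmulr0 gmul0r.
apply/seteqP; split=> z /=; last by move=> ->; exact: fin_sums0.
elim/fin_sums_ind => // x y [a [b [Ia Jb ->]]] _ ->.
by rewrite xy0 ?addr0.
Qed.

End PrimeConnected.

Section MatrixRing.
Variables (G : groupoid) (D : gring G) (K : Type) (S : K -> set G).
Hypotheses (hS : matricial D S) (hD : gr_division D).
Let M := mx_gring hS.

Definition mx_single (i j : K) (a : D) : K -> K -> D := fun k l =>
  if pselect (i = k /\ j = l) is left _ then a else 0.

Lemma mx_single_eq i j a : mx_single i j a i j = a.
Proof. by rewrite /mx_single; case: pselect => // -[]. Qed.

Lemma mx_single_neq i j a k l : ~ (i = k /\ j = l) -> mx_single i j a k l = 0.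
Proof. by rewrite /mx_single; case: pselect. Qed.

Lemma mx_single_part i j s t h a : S i s -> S j t -> gpart h a ->
  grng h = grng s -> gdom h = grng t ->
  mx_part S (gcomp (gcomp (ginv s) h) t) (mx_single i j a).
Proof.
move=> Ss St ah hs ht; have sh : gdom (ginv s) = grng h by rewrite gdom_inv.
have sht : gdom (gcomp (ginv s) h) = grng t by rewrite gdom_comp.
split.
  apply: (@sub_finite_set _ _ [set (i, j)]); last exact: finite_set1.
  move=> [k l] /= n0; apply: contrapT => E; apply: n0.
  by apply: mx_single_neq => -[ik jl]; apply: E; rewrite ik jl.
move=> k l; have [[<- <-]|E] := pselect (i = k /\ j = l); last first.
  by right; exact: mx_single_neq.
rewrite mx_single_eq; left; exists s, t; split=> //.
- by rewrite (grng_comp sht) (grng_comp sh) grng_inv.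
- by rewrite (gdom_comp sht).
- by rewrite gcomp_untwist.
Qed.

Lemma mx_mul_single_l i j a (B : K -> K -> D) k l :
  mx_mul (mx_single i j a) B k l = if pselect (i = k) is left _ then a ** B j l else 0.
Proof.
rewrite (@mx_mulE _ _ _ [:: j : {classic K}]) //.
  rewrite big_seq1; case: pselect => [<-|ik]; first by rewrite mx_single_eq.
  by rewrite mx_single_neq ?gmul0r // => -[].
move=> m; have [[_ <-]|E] := pselect (i = k /\ j = m); first by rewrite mem_head.
by rewrite mx_single_neq.
Qed.

Lemma mx_mul_single_r i j a (A : K -> K -> D) k l :
  mx_mul A (mx_single i j a) k l = if pselect (j = l) is left _ then A k i ** a else 0.
Proof.
rewrite (@mx_mulE _ _ _ [:: i : {classic K}]) //.
  rewrite big_seq1; case: pselect => [<-|ik]; first by rewrite mx_single_eq.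
  by rewrite mx_single_neq ?gmulr0 // => -[].
move=> m; have [[<- _]|E] := pselect (i = m /\ j = l); first by rewrite mem_head.
by rewrite mx_single_neq.
Qed.

Lemma mx_single_elt i j s t h a : S i s -> S j t -> gpart h a ->
  grng h = grng s -> gdom h = grng t ->
  exists2 m : M, gpart (gcomp (gcomp (ginv s) h) t) m & hs_val m = mx_single i j a.
Proof.
move=> Ss St ah hs ht; have hp := mx_single_part Ss St ah hs ht.
have hq : @hs_part G (mx_hsystem hS) (gcomp (gcomp (ginv s) h) t) (mx_single i j a).
  exact: hp.
by exists (HsRing (introT (hs_predP _) (hs_part_sums hq))).
Qed.

Lemma mx_eqP (x y : M) : (forall i j, hs_val x i j = hs_val y i j) -> x = y.
Proof. by move=> h; apply: val_inj; apply/funext => i; apply/funext => j; exact: h. Qed.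

Definition mx_diag_idem : set M := [set m : M | exists k s,
  S k s /\ hs_val m = mx_single k k (gone D (grng s))].

Lemma mx_diag_idem_ex k s : S k s -> exists2 m : M, gpart (gid (gdom s)) m &
  hs_val m = mx_single k k (gone D (grng s)).
Proof.
move=> Ss; have [||m mg mE] := mx_single_elt Ss Ss (gone_part D (grng s)).
- by rewrite grng_id.
- by rewrite gdom_id.
exists m => //; rewrite -gdom_inv gcompg1 gcompVg in mg; exact: mg.
Qed.

(** Left multiplication of the entry by the identity of [grng s] singles out, among
    the elements of [S i], the one that determines its degree. *)
Lemma mx_entry_part g (x : M) i j s : gpart g x -> S i s -> gone D (grng s) ** hs_val x i j <> 0 ->
  exists t, [/\ S j t, gdom s = grng g, gdom t = gdom g
    & gpart (gcomp (gcomp s g) (ginv t)) (hs_val x i j)].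
Proof.
move=> [_ /(_ i j)[[s' [t [Ss' St sg tg xp]]]|->]] Ss; last by rewrite gmulr0.
move=> n0; have := hom_mul_neq0 (gone_part D _) xp n0.
have dsg : gdom (gcomp s' g) = grng (ginv t) by rewrite gdom_comp// grng_inv.
rewrite gdom_id (grng_comp dsg) (grng_comp sg) => ss'.
have E : s = s' by exact: (matricial_rng hS Ss Ss' ss').
by exists t; rewrite E.
Qed.

(** A nonzero matrix [x] with [m x = x] lives in row [k]. The inverse of a nonzero
    entry [x k l], placed at position [l, k], is a right inverse of [x] up to [m]. *)
Lemma mx_diag_idem_min k s (m : M) : S k s -> gpart (gid (gdom s)) m ->
  hs_val m = mx_single k k (gone D (grng s)) -> min_idem (gdom s) m.
Proof.
move=> Ss mg mE; split=> //.
- move=> /(congr1 (fun x : M => hs_val x k k)); rewrite mE mx_single_eq.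
  exact: (matricial_supp hS Ss).
- apply: mx_eqP => i j; change (mx_mul (hs_val m) (hs_val m) i j = hs_val m i j).
  rewrite mE mx_mul_single_l; case: pselect => [<-|ki]; last first.
    by rewrite mx_single_neq // => -[].
  have [<-|kj] := pselect (k = j); first by rewrite !mx_single_eq gone_idem.
  by rewrite !mx_single_neq ?gmulr0 // => -[].
move=> g x xg mx x0.
have xE i j : hs_val x i j = if pselect (k = i) is left _
    then gone D (grng s) ** hs_val x k j else 0.
  have := mx_mul_single_l k k (gone D (grng s)) (hs_val x) i j.
  by rewrite -mE => <-; rewrite -{1}mx.
have [l xkl] : exists l, hs_val x k l <> 0.
  apply: contrapT => h; apply: x0; apply: mx_eqP => i j.
  rewrite xE; case: pselect => // _; have -> : hs_val x k j = 0.
    by apply: contrapT => n0; apply: h; exists j.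
  exact: gmulr0.
have xkE : gone D (grng s) ** hs_val x k l = hs_val x k l.
  by rewrite [RHS]xE; case: pselect.
have [t [St sg tg xp]] := mx_entry_part xg Ss (eq_ind_r (fun z => z <> 0) xkl xkE).
have dsg : gdom (gcomp s g) = grng (ginv t) by rewrite gdom_comp// grng_inv.
have rh : grng (gcomp (gcomp s g) (ginv t)) = grng s.
  by rewrite (grng_comp dsg) (grng_comp sg).
have dh : gdom (gcomp (gcomp s g) (ginv t)) = grng t.
  by rewrite (gdom_comp dsg) gdom_inv.
have [_ inv] := hD; have [b [bg xb _]] := inv _ _ xp xkl.
have [||y yg yE] := mx_single_elt St Ss bg; rewrite ?grng_inv ?gdom_inv//.
eexists; exists y; split; first exact: yg.
apply: mx_eqP => i j; change (mx_mul (hs_val x) (hs_val y) i j = hs_val m i j).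
rewrite mE yE mx_mul_single_r; case: pselect => [<-|kj]; last first.
  by rewrite mx_single_neq // => -[].
have [<-|ki] := pselect (k = i); first by rewrite mx_single_eq xb rh.
rewrite mx_single_neq => [|[]//]; rewrite xE; case: pselect => // _.
exact: gmul0r.
Qed.

(** The identity of [f] is diagonal, and its nonzero entries sit at the finitely
    many [k] for which [S k] has an element of domain [f]. *)
Lemma mx_framed : framed mx_diag_idem.
Proof.
move=> f; have fin := matricial_finite hS f.
have /choice[m hm] : forall k, exists m : M, (exists2 s, S k s & gdom s = f) ->
    [/\ mx_diag_idem m, min_idem f m
      & hs_val m = mx_single k k (mx_one D S f k k)].
  move=> k; have [[s Ss sf]|nk] := pselect (exists2 s, S k s & gdom s = f).
    have [m mg mE] := mx_diag_idem_ex Ss.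
    exists m => _; split; first by exists k, s.
      by rewrite -sf; exact: mx_diag_idem_min mg mE.
    by rewrite (mx_one_eq hS Ss sf).
  by exists 0.
have /(@finite_seqP {classic K})[r hr] := fin.
exists [seq m k | k : {classic K} <- undup r]; split.
  move=> _ /mapP[k kr ->]; rewrite mem_undup in kr.
  have : [set` r] k by []; rewrite -hr => /hm[]//.
rewrite big_map; apply: mx_eqP => i j.
rewrite (big_morph (fun x : M => hs_val x : K -> K -> D) (id1 := 0) (op1 := +%R)) //.
rewrite (mx_sumE (K := K)).
have kr (k : {classic K}) : k \in undup r -> hs_val (m k) = mx_single k k (mx_one D S f k k).
  by rewrite mem_undup => kr; have : [set` r] k by []; rewrite -hr => /hm[].
rewrite big_seq (eq_bigr (fun k : {classic K} => mx_single k k (mx_one D S f k k) i j)); last first.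
  by move=> k /kr ->.
rewrite -big_seq -[LHS]/(mx_one D S f i j).
pose i' : {classic K} := i.
have [ij|ij] := pselect (i = j); last first.
  rewrite mx_one_neq // big1 // => k _; apply: mx_single_neq => -[ki kj].
  by apply: ij; rewrite -ki.
rewrite -{}ij {j}; have [ir|ir] := boolP (i' \in undup r).
  rewrite (bigD1_seq i') ?undup_uniq //= mx_single_eq big1 ?addr0 // => k /eqP ki.
  by apply: mx_single_neq => -[].
rewrite big_seq big1 => [|k kin].
  rewrite /mx_one; case: pselect => // _; case: pselect => // h.
  have : [set` r] i by rewrite -hr; exact: h.
  by move=> ri; case/negP: ir; rewrite mem_undup.
apply: mx_single_neq => -[ki _]; move: ir; rewrite /i' -ki.
by rewrite kin.
Qed.

(** Two diagonal idempotents, at [k] and [l], are joined by the single-entry matrix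
    at position [k, l] whose entry is a nonzero homogeneous element of [D] between
    the corresponding objects; these exist because [D] is gr-prime. *)
Lemma mx_gring_simple : [set: K] !=set0 -> gr_prime D -> gr_simple M.
Proof.
move=> [k0 _] pD; apply: framed_simple mx_framed _ _.
  have [s0 Ss0] := matricial_nonempty hS k0.
  have [m mg mE] := mx_diag_idem_ex Ss0.
  have [_ m0 _ _] := mx_diag_idem_min Ss0 mg mE.
  by move=> E; apply: m0; have : [set: M] m by []; rewrite E.
move=> p q [k [s [Ss pE]]] [l [t [St qE]]].
have [h [u [uh u0 hs ht]]] := prime_connected pD (matricial_supp hS Ss)
  (matricial_supp hS St).
have [w wg wE] := mx_single_elt Ss St uh hs ht.
exists (gcomp (gcomp (ginv s) h) t), w; split=> //.
- by move=> /(congr1 (fun x : M => hs_val x k l)); rewrite wE mx_single_eq.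
- apply: mx_eqP => i j; change (mx_mul (hs_val p) (hs_val w) i j = hs_val w i j).
  rewrite pE wE mx_mul_single_l; case: pselect => [<-|ki]; last first.
    by rewrite mx_single_neq // => -[].
  have [<-|lj] := pselect (l = j); last by rewrite !mx_single_neq ?gmulr0 // => -[].
  by rewrite !mx_single_eq -hs gone_mul.
- apply: mx_eqP => i j; change (mx_mul (hs_val w) (hs_val q) i j = hs_val w i j).
  rewrite qE wE mx_mul_single_r; case: pselect => [<-|lj]; last first.
    by rewrite mx_single_neq // => -[].
  have [<-|ki] := pselect (k = i); last by rewrite !mx_single_neq ?gmul0r // => -[].
  by rewrite !mx_single_eq -ht gmul_one.
Qed.

Lemma mx_gring_artinian : obj_artinian M.
Proof. exact: framed_artinian mx_framed. Qed.

End MatrixRing.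

(** * Orthogonal decomposition of the object identities *)

Section Decomposition.
Variables (G : groupoid) (R : gring G).
Implicit Types (g h k : G) (x y z a b p q : R) (e f : gobj G) (N T : set R).
Implicit Types (S : R -> set R).

(** A graded [T] independent of [N] is enlarged by each [S y] in turn, unless
    [S y] meets [N + T], in which case it is already contained there. *)
Lemma rideal_complement N (s : seq R) S : rideal N ->
  (forall y, y \in s -> rsimple (S y)) ->
  exists T, [/\ rideal T, forall x, N x -> T x -> x = 0
    & forall y, y \in s -> S y `<=` rsum N T].
Proof.
move=> hN; elim: s => [|y s IH] hS.
  exists [set 0]; split=> //; split; first by split=> // x y -> ->; rewrite /= subr0.
    by move=> x a ->; exact: gmul0r.
  by move=> g x ->; exact: gproj0.
have [|T [hT NT sT]] := IH; first by move=> z zs; apply: hS; rewrite inE zs orbT.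
have [rS _ sS] := hS y (mem_head _ _); have rNT := rideal_rsum hN hT.
have [[z [Sz Tz z0]]|hn] := pselect (exists z, [/\ S y z, rsum N T z & z <> 0]).
  exists T; split=> // y'; rewrite inE => /orP[/eqP->|]; last exact: sT.
  move=> x Sx; have [g zg] := gproj_neq0 z0.
  have [a ->] := sS g _ x (gproj_part g z) (rideal_gproj g rS Sz) zg Sx.
  by apply: ridealM => //; exact: rideal_gproj.
exists (rsum T (S y)); split; first exact: rideal_rsum.
  move=> x Nx [t [u [Tt Su xE]]]; suff u0 : u = 0.
    by apply: NT => //; rewrite xE u0 addr0.
  apply: contrapT => u0; apply: hn; exists u; split=> //.
  exists x, (- t); split=> //; last by rewrite xE addrAC subrr add0r.
  by apply: additive_subgroupN Tt; have [] := hT.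
move=> y'; rewrite inE => /orP[/eqP->|/sT h] x.
  move=> Sx; exists 0, x; rewrite add0r; split=> //; first exact: rideal0.
  by exists 0, x; rewrite add0r; split=> //; exact: rideal0.
move=> /h[n [t [Nn Tt ->]]]; exists n, t; split=> //.
by exists t, 0; rewrite addr0; split=> //; exact: rideal0.
Qed.

Hypothesis ssR : fin_sums (simple_union R) = setT.

Lemma one_simple_sum e : exists (s : seq R) S,
  (forall y, y \in s -> rsimple (S y) /\ S y y) /\ gone R e = \sum_(y <- s) y.
Proof.
have : fin_sums (simple_union R) (gone R e) by rewrite ssR.
move=> [s [hs es]].
have /choice[S hS] : forall y, exists N, simple_union R y -> rsimple N /\ N y.
  move=> y; have [[N hN Ny]|h] := pselect (simple_union R y); first by exists N.
  by exists setT.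
by exists s, S; split=> // y /hs/hS.
Qed.

(** Write [1_e = n + t] along a complement [T] of [N], with [n] and [t] of degree
    [gid e]. For [x] in [N] the element [x - n x = t x] lies in both [N] and [T]. *)
Lemma rideal_idem e N : rideal N -> (forall x, N x -> gone R e ** x = x) ->
  exists n, [/\ N n, gpart (gid e) n & forall x, N x -> n ** x = x].
Proof.
move=> hN Ne; have [s [S [hS es]]] := one_simple_sum e.
have [T [hT NT sT]] := rideal_complement hN (fun y ys => proj1 (hS y ys)).
have : rsum N T (gone R e).
  rewrite es; apply: subgroup_sum; first by have [] := rideal_rsum hN hT.
  by move=> y ys; apply: (sT y ys); have [] := hS y ys.
move=> [n [t [Nn Tt nt]]].
exists (gproj (gid e) n); split; [exact: rideal_gproj|exact: gproj_part|].
move=> x Nx; apply/eqP; rewrite eq_sym -subr_eq0; apply/eqP.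
have E : x - gproj (gid e) n ** x = gproj (gid e) t ** x.
  rewrite -{1}(Ne x Nx) -(gproj_id (gone_part R e)) nt gprojD gmulDl.
  by rewrite addrAC subrr add0r.
apply: NT; first by apply: ridealB => //; apply: ridealM => //; exact: rideal_gproj.
by rewrite E; apply: ridealM => //; exact: rideal_gproj.
Qed.

Definition orthogonal_list (L : seq R) :=
  uniq L /\ forall p q, p \in L -> q \in L -> p <> q -> p ** q = 0.

(** Gram-Schmidt for idempotents: if [p] is the sum found for the first right
    ideals and [c = 1_e - p], then the next one contributes the right ideal
    [c (S y)], which is zero or gr-simple. In the latter case its generating
    idempotent [n] satisfies [p n = 0], and [n c] is orthogonal to [p] on both
    sides while it still generates the same right ideal. *)
Lemma orthogonal_decomp e (s : seq R) S : (forall y, y \in s -> rsimple (S y)) ->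
  exists L : seq R, [/\ orthogonal_list L, forall p, p \in L -> min_idem e p
    & forall y z, y \in s -> S y z -> (\sum_(p <- L) p) ** z = gone R e ** z].
Proof.
elim: s => [|y s IH] hS; first by exists [::].
have [|L [[uL oL] mL sL]] := IH; first by move=> z zs; apply: hS; rewrite inE zs orbT.
have sy := hS y (mem_head _ _); have [rS _ _] := sy.
set p := \sum_(p <- L) p in sL.
have pq q : q \in L -> p ** q = q.
  move=> qL; rewrite gmul_suml (bigD1_seq q) //= big_seq_cond big1 ?addr0.
    by have [_ _] := mL q qL.
  by move=> i /andP[iL /eqP iq]; exact: oL.
have qp q : q \in L -> q ** p = q.
  move=> qL; rewrite gmul_sumr (bigD1_seq q) //= big_seq_cond big1 ?addr0.
    by have [_ _] := mL q qL.
  by move=> i /andP[iL /eqP iq]; apply: oL => // E; apply: iq.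
have pp : p ** p = p by rewrite {2}/p gmul_sumr; apply: eq_big_seq.
have pe : gpart (gid e) p.
  by rewrite /p big_seq; apply: gpart_sum => q /mL[].
have ep : gone R e ** p = p by have := gone_mul pe; rewrite grng_id.
have p_e : p ** gone R e = p by have := gmul_one pe; rewrite gdom_id.
pose c := gone R e - p.
have ce : gpart (gid e) c by apply: gpartB => //; exact: gone_part.
have pc : p ** c = 0 by rewrite gmulBr p_e pp subrr.
have cp : c ** p = 0 by rewrite gmulBl ep pp subrr.
have cc : c ** c = c by rewrite {1}/c gmulBl pc subr0 -[in LHS](grng_id e) gone_mul.
have [hn|hn] := pselect (exists2 z, S y z & c ** z <> 0); last first.
  exists L; split=> // y' z; rewrite inE => /orP[/eqP->|]; last exact: sL.
  move=> Sz; apply/eqP; rewrite eq_sym -subr_eq0 -gmulBl; apply/eqP.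
  by apply: contrapT => n0; apply: hn; exists z.
have [rN [x0 Nx0 x00] sN] := rsimple_limage ce sy hn.
have pN x : limage c (S y) x -> p ** x = 0.
  by move=> [z _ ->]; rewrite gmulA pc gmul0r.
have [|n [Nn ne nN]] := @rideal_idem e _ rN.
  by move=> _ [z _ ->]; rewrite gmulA -{1}(grng_id e) gone_mul.
pose q := n ** c.
have qe : gpart (gid e) q.
  by have := gpart_mul ne ce; rewrite gdom_id grng_id => /(_ erefl);
    rewrite -{1}(grng_id e) gcomp1g.
have Nq : limage c (S y) q by exact: ridealM.
have cN x : limage c (S y) x -> c ** x = x.
  by move=> [z _ ->]; rewrite gmulA cc.
have qN x : limage c (S y) x -> q ** x = x.
  by move=> Nx; rewrite -gmulA cN // nN.
have q0 : q <> 0 by move=> q0; apply: x00; rewrite -(qN _ Nx0) q0 gmul0r.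
have q_p : q ** p = 0 by rewrite -gmulA cp gmulr0.
have p_q : p ** q = 0 by exact: pN.
have qL : q \notin L by apply/negP => /pq; rewrite p_q => /esym.
exists (q :: L); split.
- split=> [|a b]; first by rewrite /= qL.
  rewrite !inE => /orP[/eqP->|aL] /orP[/eqP->|bL] ab //.
  + by rewrite -(pq b bL) gmulA q_p gmul0r.
  + by rewrite -(qp a aL) -gmulA p_q gmulr0.
  + exact: oL.
- move=> a; rewrite inE => /orP[/eqP->|/mL//]; split=> //; first exact: qN.
  move=> g x xg qx xn0; have Nx : limage c (S y) x.
    by rewrite -qx; exact: ridealM.
  have [b qb] := sN g x q xg Nx xn0 Nq.
  have [h [_ _ qh]] := hom_quotient xg qe qb q0.
  by exists h, (gproj h b); split=> //; exact: gproj_part.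
- move=> y' z; rewrite inE big_cons gmulDl -/p => /orP[/eqP->|y's] Sz.
    have cz : limage c (S y) (c ** z) by exists z.
    have -> : q ** z = c ** z.
      by rewrite -[RHS](qN _ cz) [RHS]gmulA /q -!gmulA; congr (n ** _); rewrite gmulA cc.
    by rewrite -gmulDl subrK.
  rewrite (sL y' z y's Sz); have := congr1 (fun x => q ** x) (sL y' z y's Sz).
  rewrite /= !gmulA q_p gmul0r; have -> : q ** gone R e = q.
    by have := gmul_one qe; rewrite gdom_id.
  by move=> <-; rewrite add0r.
Qed.

(** Idempotents chosen at different objects are orthogonal because their degrees are
    not composable, so the decompositions of all object identities merge into
    a single orthogonal system. *)
Lemma idem_system : exists (K : choiceType) (ob : K -> gobj G) (p : K -> R)
    (L : gobj G -> seq K),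
  [/\ forall k : K, min_idem (ob k) (p k), forall k l : K, k <> l -> p k ** p l = 0,
      forall e, uniq (L e), forall e (k : K), k \in L e <-> ob k = e
    & forall e, gone R e = \sum_(k <- L e) p k].
Proof.
have /choice[E hE] : forall e, exists L : seq R, [/\ orthogonal_list L,
    forall p, p \in L -> min_idem e p & gone R e = \sum_(p <- L) p].
  move=> e; have [s [S [hS es]]] := one_simple_sum e.
  have [L [oL mL sL]] := orthogonal_decomp e (fun y ys => proj1 (hS y ys)).
  exists L; split=> //; have pe : gpart (gid e) (\sum_(p <- L) p).
    by rewrite big_seq; apply: gpart_sum => q /mL[].
  rewrite -[RHS](gmul_one pe) gdom_id -[LHS]gone_idem {2 3}es !gmul_sumr.
  by apply: eq_big_seq => y ys; rewrite (sL y) //; have [] := hS y ys.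
pose K := {k : {classic gobj G} * R | k.2 \in E k.1}.
pose L e : seq K := pmap insub [seq ((e : {classic gobj G}), x) | x <- E e].
have LE e : [seq val i | i <- L e] = [seq ((e : {classic gobj G}), x) | x <- E e].
  rewrite /L (pmap_filter (insubK _)); apply/all_filterP/allP.
  by move=> _ /mapP[x xE ->]; rewrite /= insubT.
exists K, (fun i => (val i).1), (fun i => (val i).2), L; split.
- by move=> [[e x] xE] /=; have [_ + _] := hE e; apply.
- move=> [[e x] xE] [[f y] yE] kl /=; have [[_ oe] me _] := hE e.
  have [_ mf _] := hE f; have [xe _ _ _] := me x xE.
  have [yf _ _ _] := mf y yE.
  have [ef|ef] := pselect (e = f).
    subst f; apply: oe => // xy; subst y; apply: kl.
    exact: val_inj.
  by apply: gpart_mul0 xe yf _; rewrite gdom_id grng_id.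
- move=> e; rewrite -(map_inj_uniq val_inj) LE map_inj_uniq => [|x y []//].
  by have [[]] := hE e.
- move=> e k; rewrite -(mem_map val_inj) LE; split.
    by move=> /mapP[x _ ->].
  case: k => [[f x] xE] /= fe; rewrite -fe; exact: map_f.
- move=> e; have [_ _ ->] := hE e; rewrite -[RHS](big_map val xpredT snd).
  by rewrite LE big_map.
Qed.

End Decomposition.

(** * Corner rings *)

Section Corner.
Variables (G : groupoid) (R : gring G) (e : gobj G) (p : R).
Hypothesis mp : min_idem e p.
Implicit Types (g h : G) (x y z : R).

Definition corner_part g : set R := [set x | [/\ gpart g x, p ** x = x & x ** p = x]].

Definition corner_one f : R := if pselect (f = e) is left _ then p else 0.

Lemma gpart_idem_l g x : gpart g x -> gpart g (p ** x).
Proof.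
move=> xg; have [->|/eqP n0] := eqVneq (p ** x) 0; first exact: gpart_zero.
have ge := min_idem_rng mp xg n0; have [pe _ _ _] := mp.
have := gpart_mul pe xg; rewrite gdom_id -ge => /(_ erefl).
by rewrite gcomp1g.
Qed.

Lemma gpart_idem_r g x : gpart g x -> gpart g (x ** p).
Proof.
move=> xg; have [->|/eqP n0] := eqVneq (x ** p) 0; first exact: gpart_zero.
have ge := min_idem_dom mp xg n0; have [pe _ _ _] := mp.
have := gpart_mul xg pe; rewrite grng_id -ge => /(_ erefl).
by rewrite gcompg1.
Qed.

Lemma corner_part_rng g x : corner_part g x -> x <> 0 -> grng g = e.
Proof. by move=> [xg px _] x0; apply: (min_idem_rng mp xg); rewrite px. Qed.

Lemma corner_part_dom g x : corner_part g x -> x <> 0 -> gdom g = e.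
Proof. by move=> [xg _ xp] x0; apply: (min_idem_dom mp xg); rewrite xp. Qed.

Definition corner_hsystem : hsystem G.
Proof.
refine (@HSystem G R (@gmul G R) corner_part corner_one _ _ _ _ _ _ _ _ _ _).
- move=> g; split; first by split; rewrite ?gmulr0 ?gmul0r//; exact: gpart_zero.
  move=> x y [xg px xp] [yg py yp]; split; first exact: gpartB.
    by rewrite gmulBr px py.
  by rewrite gmulBl xp yp.
- move=> n g x gI xC s0 i; have [_ _ ind] := gpart_grading R.
  by apply: ind gI _ s0 i => i; have [] := xC i.
- by move=> x y z _ _ _; exact: gmulA.
- by move=> x y z _ _ _; exact: gmulDl.
- by move=> x y z _ _ _; exact: gmulDr.
- move=> g h x y [xg px xp] [yh py yp] gh; split; first exact: gpart_mul.
    by rewrite gmulA px.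
  by rewrite -gmulA yp.
- by move=> g h x y [xg px xp] [yh py yp]; exact: gpart_mul0.
- move=> f; have [pe _ pp _] := mp.
  rewrite /corner_one; case: pselect => [->//|_].
  by split; rewrite ?gmulr0 ?gmul0r//; exact: gpart_zero.
- move=> g x hx; have [->|/eqP x0] := eqVneq x 0; first exact: gmulr0.
  rewrite /corner_one; case: pselect => [_|]; first by have [] := hx.
  by case; exact: corner_part_rng hx x0.
- move=> g x hx; have [->|/eqP x0] := eqVneq x 0; first exact: gmul0r.
  rewrite /corner_one; case: pselect => [_|]; first by have [] := hx.
  by case; exact: corner_part_dom hx x0.
Defined.

Definition corner : gring G := gring_of corner_hsystem.

Lemma to_corner_part g x : gpart g x -> corner_part g (p ** x ** p).
Proof.
have [_ _ pp _] := mp.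
move=> xg; split; first exact/gpart_idem_r/gpart_idem_l.
  by rewrite !gmulA pp.
by rewrite -!gmulA pp.
Qed.

Lemma to_cornerD : {morph (fun x => p ** x ** p) : x y / x + y}.
Proof. by move=> x y; rewrite gmulDr gmulDl. Qed.

Definition to_corner : R -> corner :=
  @hs_lift G R corner_hsystem _ to_cornerD to_corner_part.

Lemma corner_val (a : corner) : p ** hs_val a = hs_val a /\ hs_val a ** p = hs_val a.
Proof.
have : hs_sums (hs_val a) by exact: hs_ringS.
elim/fin_sums_ind => [|x y [g _ [_ px xp]] _ [py yp]].
  by rewrite gmulr0 gmul0r.
by rewrite gmulDr gmulDl px py xp yp.
Qed.

Lemma supp_corner : supp corner `<=` ghom e e.
Proof.
move=> g [x [xg px xp] x0].
have x0' : hs_val x <> 0 by move=> E; apply: x0; exact: val_inj.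
split; first by apply: (min_idem_rng mp xg); rewrite px.
by apply: (min_idem_dom mp xg); rewrite xp.
Qed.

End Corner.

Section Links.
Variables (G : groupoid) (R : gring G).
Implicit Types (g h : G) (x y z u v p q : R) (e f : gobj G).

(** A graded form of Schur's lemma: [u] stands for a nonzero homomorphism between
    the gr-simple modules [q R] and [p R], hence for an isomorphism. *)
Lemma min_idem_link e p f q g u : min_idem e p -> min_idem f q ->
  gpart g u -> u <> 0 -> p ** u = u -> u ** q = u ->
  [/\ grng g = e, gdom g = f & exists v, [/\ gpart (ginv g) v, q ** v = v,
    v ** p = v, u ** v = p & v ** u = q]].
Proof.
move=> mp mq ug u0 pu uq.
have [pe p0 pp pmin] := mp; have [qf q0 qq qmin] := mq.
have ge : grng g = e by apply: (min_idem_rng mp ug); rewrite pu.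
have gf : gdom g = f by apply: (min_idem_dom mq ug); rewrite uq.
split=> //; have [h [y [yh uy]]] := pmin g u ug pu u0.
have uy0 : u ** y <> 0 by rewrite uy.
have gh := hom_mul_neq0 ug yh uy0.
have E : gcomp g h = gid e.
  by apply: (gpart_deg_uniq (gpart_mul ug yh gh)); rewrite uy.
have hE : h = ginv g by rewrite -(gcompKl gh) E -ge -gdom_inv gcompg1.
rewrite {}hE in yh gh E.
exists (q ** y ** p); have qyp : gpart (ginv g) (q ** y ** p).
  exact: (gpart_idem_r mp (gpart_idem_l mq yh)).
have uv : u ** (q ** y ** p) = p by rewrite !gmulA uq uy.
have qv : q ** (q ** y ** p) = q ** y ** p by rewrite !gmulA qq.
have vp : (q ** y ** p) ** p = q ** y ** p by rewrite -!gmulA pp.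
split=> //; set v := q ** y ** p in uv qv vp qyp *.
have v0 : v <> 0 by move=> v0; apply: p0; rewrite -uv v0 gmulr0.
have [k [z [_ vz]]] := qmin _ v qyp qv v0.
by rewrite -uq -vz (gmulA u v z) uv (gmulA v p z) vp.
Qed.

(** Apply the previous lemma with both idempotents equal to [p]. *)
Lemma corner_division e p (mp : min_idem e p) : gr_division (corner mp).
Proof.
have [pe p0 pp _] := mp; split.
  move=> E; have : [set: corner mp] (gone (corner mp) e) by [].
  rewrite E => /(congr1 (fun x : corner mp => hs_val x)) /=.
  by rewrite /corner_one; case: pselect.
move=> g a [ag pa ap] a0.
have a0' : hs_val a <> 0 by move=> E; apply: a0; exact: val_inj.
have [ge gf [v [vg pv vp av va]]] := min_idem_link mp mp ag a0' pa ap.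
have hv : @hs_part G (corner_hsystem mp) (ginv g) v by split.
exists (HsRing (introT (hs_predP _) (hs_part_sums hv))).
split; first exact: hv.
  by apply: val_inj; rewrite /= /corner_one ge; case: pselect.
by apply: val_inj; rewrite /= /corner_one gf; case: pselect.
Qed.

End Links.

(** * A criterion for summability *)

Section SummableCriterion.
Variables (G : groupoid) (J : Type) (Q : J -> gring G).

Lemma summable_of_finite :
  (forall g, finite_set [set j | exists2 x : Q j, gpart g x & x <> 0]) -> summable Q.
Proof.
move=> fin; apply/seteqP; split=> x.
  elim/fin_sums_ind => [|y z [g _ yg] _ fz].
    by apply: (@sub_finite_set _ _ set0) => // j [].
  apply: (@sub_finite_set _ _ ([set j | y j <> 0] `|` [set j | z j <> 0])).
    move=> j /= yz0; have [y0|/eqP] := eqVneq (y j) 0; last by left.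
    by right=> z0; apply: yz0; rewrite -[LHS]/(y j + z j) y0 z0 addr0.
  rewrite finite_setU; split=> //; apply: sub_finite_set (fin g) => j y0.
  by exists (y j).
move=> /(@finite_seqP {classic J})[s hs].
rewrite (@dsingle_sum J Q (undup s) x) ?undup_uniq//; last first.
  by move=> j xj; rewrite mem_undup; have : [set` s] j by rewrite -hs.
elim: (undup s) => [|j t IH]; first by rewrite big_nil; exact: fin_sums0.
rewrite big_cons; apply: fin_sumsD => {t IH} //.
elim/homog_ind: (x j) => [|g y yg|y z hy hz].
- by rewrite (additive_map0 (@dsingleD _ _ Q j)); exact: fin_sums0.
- by apply: fin_sums1; exists g => //; exact: dsingle_part.
- by rewrite dsingleD; exact: fin_sumsD.
Qed.

End SummableCriterion.

(** * The structure of gr-semisimple rings *)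

Lemma mem_classic (T : eqType) (s : seq T) (x : T) :
  ((x : {classic T}) \in (s : seq {classic T})) = (x \in s).
Proof.
elim: s => // y s IH; rewrite !inE; congr orb; last exact: IH.
by apply/eqP/eqP.
Qed.

Section Structure.
Variables (G : groupoid) (R : gring G) (K : choiceType) (ob : K -> gobj G)
  (p : K -> R) (L : gobj G -> seq K).
Hypotheses (mp : forall k, min_idem (ob k) (p k))
  (op : forall k l, k <> l -> p k ** p l = 0)
  (uL : forall e, uniq (L e)) (memL : forall e k, k \in L e <-> ob k = e)
  (one_sum : forall e, gone R e = \sum_(k <- L e) p k).
Implicit Types (g h : G) (x y z u v : R) (e f : gobj G) (k l m : K).

Record link_inv k l g u v : Prop := LinkInv {
  link_l : gpart g u;
  link_r : gpart (ginv g) v;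
  link_rng : grng g = ob k;
  link_dom : gdom g = ob l;
  link_pl : p k ** u = u;
  link_lp : u ** p l = u;
  link_pr : p l ** v = v;
  link_rp : v ** p k = v;
  link_lr : u ** v = p k;
  link_rl : v ** u = p l }.

(** By Schur's lemma this says that [p k R] and [p l R] are isomorphic up to a shift
    of degrees. *)
Definition linked k l := exists g u, [/\ gpart g u, u <> 0, p k ** u = u & u ** p l = u].

Lemma linked_inv k l : linked k l -> exists g u v, link_inv k l g u v.
Proof.
move=> [g [u [ug u0 pu up]]].
have [gk gl [v [vg pv vp uv vu]]] := min_idem_link (mp k) (mp l) ug u0 pu up.
by exists g, u, v.
Qed.

Lemma idem_neq0 k : p k <> 0. Proof. by have [] := mp k. Qed.

Lemma idem_idem k : p k ** p k = p k. Proof. by have [] := mp k. Qed.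

Lemma linked_refl k : linked k k.
Proof.
exists (gid (ob k)), (p k); rewrite !idem_idem; split=> //.
  by have [] := mp k.
exact: idem_neq0.
Qed.

Lemma linked_sym k l : linked k l -> linked l k.
Proof.
move=> /linked_inv[g [u [v []]]] ug vg _ _ pu up pv vp uv vu.
exists (ginv g), v; split=> // v0; apply: (@idem_neq0 k).
by rewrite -uv v0 gmulr0.
Qed.

(** The product [u u'] of two links is nonzero because [v u = p l] is the identity on
    [u']. *)
Lemma linked_trans k l m : linked k l -> linked l m -> linked k m.
Proof.
move=> /linked_inv[g [u [v []]]] ug vg _ gl pu up pv vp uv vu.
move=> /linked_inv[h [u' [v' []]]] ug' vg' hl _ pu' up' pv' vp' uv' vu'.
exists (gcomp g h), (u ** u'); split.
- by apply: gpart_mul => //; rewrite gl hl.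
- move=> uu0; apply: (@idem_neq0 l).
  by rewrite -uv' -pu' -vu -(gmulA v) uu0 gmulr0 gmul0r.
- by rewrite gmulA pu.
- by rewrite -gmulA up'.
Qed.

(** A canonical member of each class of linked idempotents. *)
Definition rep k : K := 
  projT1 (@cid _ (linked k) (ex_intro (linked k) k (linked_refl k))).

Lemma rep_linked k : linked (rep k) k.
Proof. by apply: linked_sym; rewrite /rep; case: cid. Qed.

Lemma rep_eq k l : linked k l -> rep k = rep l.
Proof.
move=> kl; have E : linked k = linked l.
  apply/funext => m; apply/propext; split; last exact: linked_trans.
  by apply: linked_trans; exact: linked_sym.
rewrite /rep; move: (ex_intro _ _ (linked_refl k)) (ex_intro _ _ (linked_refl l)).
by rewrite E => a b; rewrite (Prop_irrelevance a b).
Qed.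

Lemma rep_rep k : rep (rep k) = rep k.
Proof. exact/rep_eq/rep_linked. Qed.

Lemma rep_eq_hom g x k l : gpart g x -> p k ** x ** p l <> 0 -> rep k = rep l.
Proof.
move=> xg n0; apply: rep_eq; exists g, (p k ** x ** p l); split=> //.
- exact/(gpart_idem_r (mp l))/(gpart_idem_l (mp k)).
- by rewrite !gmulA idem_idem.
- by rewrite -!gmulA idem_idem.
Qed.

Lemma link_triple k : exists t : G * R * R, link_inv (rep k) k t.1.1 t.1.2 t.2.
Proof. by have [g [u [v h]]] := linked_inv (rep_linked k); exists (g, u, v). Qed.

(** A chosen isomorphism [lu k] from [p k R] to [p (rep k) R], its degree [ldeg k]
    and its inverse [lv k]. *)
Definition ldeg k := (projT1 (cid (link_triple k))).1.1.
Definition lu k := (projT1 (cid (link_triple k))).1.2.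
Definition lv k := (projT1 (cid (link_triple k))).2.

Lemma linkP k : link_inv (rep k) k (ldeg k) (lu k) (lv k).
Proof. by rewrite /ldeg /lu /lv; case: cid. Qed.

Lemma lulv_neq k l : k <> l -> lu k ** lv l = 0.
Proof.
move=> kl; rewrite -(link_lp (linkP k)) -(link_pr (linkP l)).
by rewrite -gmulA (gmulA (p k)) op // gmul0r gmulr0.
Qed.

(** Classes of linked idempotents, each encoded by its canonical member. *)
Definition link_class := {j : K | rep j == j}.
Definition class_member (j : link_class) := {k : K | rep k == val j}.

Lemma rep_member (j : link_class) (k : class_member j) : rep (val k) = val j.
Proof. exact/eqP/(valP k). Qed.

Definition class_of k : link_class := exist _ (rep k) (introT eqP (rep_rep k)).
Definition member_of k : class_member (class_of k) := exist _ k (eqxx (rep k)).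

(** The type of members depends on the class, so a member of [j] and the same
    idempotent viewed as a member of its own class live in different types. *)
Lemma member_ofE (T : Type) (F : forall j, class_member j -> T) (j : link_class)
    (k : class_member j) :
  F (class_of (val k)) (member_of (val k)) = F j k.
Proof.
have E : j = class_of (val k) by apply: val_inj; rewrite /= rep_member.
case: k E => k hk /= E; subst j; congr F; exact: val_inj.
Qed.

Definition members_at (j : link_class) e : seq (class_member j) := pmap insub (L e).

Lemma mem_members_at (j : link_class) e (k : class_member j) :
  k \in members_at j e <-> ob (val k) = e.
Proof. by rewrite /members_at mem_pmap_sub; exact: memL. Qed.

Lemma members_at_val (j : link_class) e : [seq val i | i <- members_at j e] =
  [seq k <- L e | rep k == val j].
Proof.
by rewrite /members_at (pmap_filter (insubK _)); apply: eq_filter => k; rewrite isSome_insub.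
Qed.

Lemma members_at_uniq (j : link_class) e : uniq (members_at j e : seq {classic (class_member j)}).
Proof.
rewrite -(map_inj_uniq (f := (val : {classic class_member j} -> K))); last exact: val_inj.
by rewrite [map _ _]members_at_val filter_uniq.
Qed.

Definition class_div (j : link_class) : gring G := corner (mp (val j)).
Definition class_deg (j : link_class) (k : class_member j) : G := ldeg (val k).

Lemma member_link j (k : class_member j) :
  link_inv (val j) (val k) (class_deg k) (lu (val k)) (lv (val k)).
Proof. by have := linkP (val k); rewrite rep_member. Qed.

Lemma class_div_division j : gr_division (class_div j). Proof. exact: corner_division. Qed.

Lemma class_div_supp j : supp (class_div j) `<=` ghom (ob (val j)) (ob (val j)).
Proof. exact: supp_corner. Qed.

Lemma class_deg_rng j (k : class_member j) : grng (class_deg k) = ob (val j).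
Proof. exact: link_rng (member_link k). Qed.

Lemma class_deg_dom j (k : class_member j) : gdom (class_deg k) = ob (val k).
Proof. exact: link_dom (member_link k). Qed.

Lemma class_deg_d_finite j : d_finite (@class_deg j).
Proof.
move=> e; apply: (@sub_finite_set _ _ [set` members_at j e]); last exact: finite_seq.
by move=> k /=; rewrite class_deg_dom => /mem_members_at.
Qed.

Definition class_mx j := mx_gring1 (@class_div_division j) (@class_div_supp j) (@class_deg_rng j)
  (@class_deg_d_finite j).

Definition class_sets j (k : class_member j) : set G := [set class_deg k].

(** Through the isomorphisms [lu] and [lv], the block [p k x p l] of [x] becomes an
    element of the corner at the representative of the class. *)
Definition class_entry j x : class_member j -> class_member j -> class_div j :=
  fun (k l : class_member j) =>
  to_corner (mp (val j)) (lu (val k) ** x ** lv (val l)).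

Lemma class_entryE j x (k l : class_member j) :
  hs_val (class_entry x k l) = lu (val k) ** x ** lv (val l).
Proof.
by rewrite /= !gmulA (link_pl (member_link k)) -gmulA (link_rp (member_link l)).
Qed.

Lemma class_entryD j : {morph (fun x => @class_entry j x) : x y / x + y}.
Proof.
move=> x y; apply/funext => k; apply/funext => l; apply: val_inj.
change (hs_val (class_entry (x + y) k l) = hs_val (class_entry x k l) + hs_val (class_entry y k l)).
by rewrite !class_entryE gmulDr gmulDl.
Qed.

Lemma lu_mul g x k : gpart g x -> lu k ** x <> 0 -> ob k = grng g.
Proof.
move=> xg n0; rewrite -(link_dom (linkP k)).
exact: hom_mul_neq0 (link_l (linkP k)) xg n0.
Qed.

Lemma mul_lv g x l : gpart g x -> x ** lv l <> 0 -> ob l = gdom g.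
Proof.
move=> xg n0; rewrite -(link_dom (linkP l)) -grng_inv.
exact/esym/(hom_mul_neq0 xg (link_r (linkP l)) n0).
Qed.

Lemma class_entry_neq0 j g x (k l : class_member j) : gpart g x -> class_entry x k l <> 0 ->
  ob (val k) = grng g /\ ob (val l) = gdom g.
Proof.
move=> xg n0; have n0' : lu (val k) ** x ** lv (val l) <> 0.
  move=> E; apply: n0; apply: val_inj.
  by rewrite -[LHS]/(hs_val (class_entry x k l)) class_entryE E.
split.
  by apply: lu_mul xg _ => E; apply: n0'; rewrite E gmul0r.
by apply: mul_lv xg _ => E; apply: n0'; rewrite -gmulA E gmulr0.
Qed.

Lemma class_entry_part j g x : gpart g x -> mx_part (@class_sets j) g (class_entry x).
Proof.
move=> xg; split.
  apply: (@sub_finite_set _ _ ([set` members_at j (grng g)] `*` [set` members_at j (gdom g)])).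
    by move=> [k l] /= /(class_entry_neq0 xg)[? ?]; split; exact/mem_members_at.
  by apply: finite_setX; exact: finite_seq.
move=> k l; have [E|/eqP n0] := eqVneq (class_entry x k l) 0; first by right.
have [kg lg] := class_entry_neq0 xg n0; left; exists (class_deg k), (class_deg l).
split=> //; rewrite ?class_deg_dom//.
apply: (proj2 (additive_graded_lift _ _)).
have dk : gdom (ldeg (val k)) = grng g by rewrite (link_dom (linkP _)).
have dl : gdom g = grng (ginv (ldeg (val l))) by rewrite grng_inv (link_dom (linkP _)).
apply: gpart_mul; [|exact: link_r (linkP _)|by rewrite gdom_comp].
by apply: gpart_mul => //; exact: link_l (linkP _).
Qed.

Definition to_class_mx j : R -> class_mx j := @hs_lift G R
  (mx_hsystem (matricial_singleton (@class_div_division j) (@class_div_supp j) (@class_deg_rng j)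
  (@class_deg_d_finite j))) _ (@class_entryD j) (@class_entry_part j).

Lemma to_class_mx_additive j : additive_graded (@to_class_mx j).
Proof. exact: additive_graded_lift. Qed.

Lemma to_class_mxD : {morph (fun x => (fun j => to_class_mx j x) : dprod class_mx) : x y / x + y}.
Proof.
move=> x y; apply: functional_extensionality_dep => j.
exact: (proj1 (@to_class_mx_additive j) x y).
Qed.

Lemma to_class_mx_part g x : gpart g x -> prod_part (R := class_mx) g (fun j => to_class_mx j x).
Proof. by move=> xg j; exact: (proj2 (@to_class_mx_additive j) g x xg). Qed.

Definition to_prod : R -> gr_prod class_mx :=
  @hs_lift G R (prod_hsystem class_mx) _ to_class_mxD to_class_mx_part.

(** Expand [x = x 1_f] at the domain [f] of [x]: the idempotents outside the class [j]
    do not contribute, since [p (val j) x p m] vanishes for unlinked [m]. *)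
Lemma sum_members_at j g x y : gpart g x -> p (val j) ** x = x ->
  x = \sum_(i <- members_at j (gdom g)) x ** p (val i).
Proof.
move=> xg px; rewrite -{1}(gmul_one xg) one_sum gmul_sumr.
rewrite (bigID (fun m => rep m == val j)) /= [X in _ + X]big1 ?addr0.
  by rewrite -big_filter -members_at_val big_map.
move=> m /eqP mj; apply: contrapT => n0; apply: mj.
rewrite -(eqP (valP j)); apply/esym/(@rep_eq_hom g x) => //.
by rewrite px.
Qed.

(** Between [x] and [y] the sum of the [lv m ** lu m = p m] over the members of the
    class acts as the identity. *)
Lemma to_class_mxM j g h x y : gpart g x -> gpart h y ->
  to_class_mx j (x ** y) = to_class_mx j x ** to_class_mx j y.
Proof.
move=> xg yh; apply: mx_eqP => k l.
change (class_entry (x ** y) k l = mx_mul (@class_entry j x) (@class_entry j y) k l).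
rewrite (mx_mulE (r := members_at j (gdom g))) ?members_at_uniq//; last first.
  move=> m xm _; have [_ /mem_members_at mg] := class_entry_neq0 xg xm.
  by rewrite mem_classic.
have [t _ xt] := gpart_hom_mul (link_l (linkP (val k))) xg.
have pk : p (val j) ** (lu (val k) ** x) = lu (val k) ** x.
  by rewrite gmulA (link_pl (member_link k)).
have td : lu (val k) ** x <> 0 -> gdom t = gdom g.
  move=> n0; rewrite -(gmul_one xg) gmulA in n0.
  by have := hom_mul_neq0 xt (gone_part R (gdom g)) n0; rewrite grng_id.
have E : lu (val k) ** x = \sum_(i <- members_at j (gdom g)) lu (val k) ** x ** p (val i).
  have [z0|/eqP z0] := eqVneq (lu (val k) ** x) 0.
    by rewrite z0 big1 // => i _; rewrite gmul0r.
  by rewrite -(td z0); exact: sum_members_at xt pk.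
apply: val_inj; rewrite [RHS](big_morph val (id1 := 0) (op1 := +%R)) //.
rewrite [LHS]class_entryE gmulA E !gmul_suml; apply: eq_bigr => i _.
change (lu (val k) ** x ** p (val i) ** y ** lv (val l) =
  hs_val (class_entry x k i) ** hs_val (class_entry y i l)).
by rewrite !class_entryE -(link_rl (linkP (val i))) !gmulA.
Qed.

(** If all coordinates of [x] vanish, then so do all blocks [p k x p l] with linked
    [k] and [l]; the other blocks are zero in any case. *)
Lemma to_prod_inj g x : gpart g x -> to_prod x = 0 -> x = 0.
Proof.
move=> xg x0; have kl0 (k l : K) : p k ** x ** p l = 0.
  apply: contrapT => n0; have kl := rep_eq_hom xg n0; apply: n0.
  have hl : rep l == val (class_of k) by rewrite /= kl.
  have := congr1 (fun z : gr_prod class_mx => hs_val (hs_val (hs_val z (class_of k))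
    (member_of k) (exist _ l hl))) x0.
  rewrite -[LHS]/(hs_val (class_entry x (member_of k) (exist _ l hl : class_member (class_of k)))).
  rewrite class_entryE -[RHS]/(0 : R) /= => E.
  rewrite -(link_rl (linkP k)) -(link_rl (linkP l)).
  rewrite !gmulA -(gmulA (lv k)) -(gmulA (lv k) _ (lv l)) E.
  by rewrite gmulr0 gmul0r.
rewrite -(gone_mul xg) -(gmul_one xg) gmulA !one_sum !gmul_suml big1 // => k _.
by rewrite gmul_sumr big1.
Qed.

(** The preimage of [y] is the sum of the [lv k ** a ** lu l], where [a] runs over the
    entries of [y]; only finitely many are nonzero, since they sit at the objects
    [grng g] and [gdom g]. *)
Lemma to_prod_surj g (y : gr_prod class_mx) : gpart g y ->
  exists2 x, gpart g x & to_prod x = y.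
Proof.
move=> yg; pose a j (k l : class_member j) : R := hs_val (hs_val (hs_val y j) k l).
have aP j (k l : class_member j) : a j k l <> 0 ->
    [/\ ob (val k) = grng g, ob (val l) = gdom g
      & gpart (gcomp (gcomp (class_deg k) g) (ginv (class_deg l))) (a j k l)].
  move=> n0; have [_ /(_ k l)[[s [t [-> -> sg tg st]]]|E]] := yg j.
    by rewrite -sg -tg !class_deg_dom; split=> //; have [] := st.
  by case: n0; exact: (congr1 (fun z : class_div j => hs_val z) E).
have pa j (k l : class_member j) : p (val j) ** a j k l = a j k l /\ a j k l ** p (val j) = a j k l.
  exact: corner_val.
(* The row [k] of the matrix over the class [j], carried back to [R]. *)
pose X j (k : class_member j) :=
  \sum_(i <- members_at j (gdom g)) lv (val k) ** a j k i ** lu (val i).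
pose x := \sum_(k <- L (grng g)) X (class_of k) (member_of k).
have xg : gpart g x.
  apply: gpart_sum => k _; apply: gpart_sum => i _.
  have [E|/eqP n0] := eqVneq (a (class_of k) (member_of k) i) 0.
    by rewrite E gmulr0 gmul0r; exact: gpart_zero.
  have [kg ig ag] := aP _ _ _ n0.
  have kg' : gdom (ldeg k) = grng g by rewrite (link_dom (linkP k)).
  have ig' : gdom (class_deg i) = gdom g by rewrite class_deg_dom.
  have dsg : gdom (gcomp (ldeg k) g) = grng (ginv (class_deg i)).
    by rewrite gdom_comp// grng_inv.
  have d1 : gdom (ginv (ldeg k)) = grng (gcomp (gcomp (ldeg k) g) (ginv (class_deg i))).
    by rewrite gdom_inv (grng_comp dsg) (grng_comp kg').
  rewrite -(gcomp_twistK kg' ig').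
  apply: gpart_mul; [|exact: link_l (linkP _)|].
    by apply: gpart_mul ag d1; exact: link_r (linkP _).
  by rewrite (gdom_comp d1) (gdom_comp dsg) gdom_inv.
have luX j (k l : class_member j) : lu (val k) ** X j k ** lv (val l) = a j k l.
  have [pal alp] := pa j k l.
  have E i : lu (val k) ** (lv (val k) ** a j k i ** lu (val i)) ** lv (val l) =
      a j k i ** (lu (val i) ** lv (val l)).
    rewrite !gmulA (link_lr (member_link k)).
    by have [-> _] := pa j k i.
  rewrite /X gmul_sumr gmul_suml; under eq_bigr do rewrite E.
  have [ll|ll] := boolP (l \in members_at j (gdom g)).
    have ulm : uniq (members_at j (gdom g)).
      by rewrite -(map_inj_uniq val_inj) members_at_val filter_uniq.
    rewrite (bigD1_seq l) //= (link_lr (member_link l)) alp.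
    rewrite big1 ?addr0 // => i /eqP il; rewrite lulv_neq ?gmulr0 //.
    by move=> /val_inj.
  rewrite big_seq big1 => [|i ilm].
    apply/esym; apply: contrapT => /aP[_ lg _]; case/negP: ll.
    exact/mem_members_at.
  rewrite lulv_neq ?gmulr0 // => /val_inj il; case/negP: ll.
  by rewrite -il.
have lux j (k : class_member j) (l : class_member j) : lu (val k) ** x ** lv (val l) = a j k l.
  rewrite /x gmul_sumr gmul_suml.
  have nk i : i <> val k -> lu (val k) ** X (class_of i) (member_of i) = 0.
    move=> ik; rewrite gmul_sumr big1 // => m _; rewrite !gmulA /= lulv_neq ?gmul0r//.
    by move=> E; apply: ik.
  have [kL|kL] := boolP (val k \in L (grng g)).
    rewrite (bigD1_seq (val k)) //= (member_ofE X) luX big1 ?addr0 // => i /eqP ik.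
    by rewrite nk // gmul0r.
  rewrite big_seq big1 => [|i iL]; last first.
    by rewrite nk ?gmul0r // => ik; rewrite -ik iL in kL.
  apply/esym; apply: contrapT => /aP[kg _ _]; case/negP: kL.
  exact/memL.
exists x => //; apply: val_inj; apply: functional_extensionality_dep => j.
apply: mx_eqP => k l; apply: val_inj.
rewrite -[LHS]/(hs_val (class_entry x k l)) class_entryE; exact: lux.
Qed.

(** A nonzero element of degree [g] in the matrix ring of a class requires a member
    of the class at the object [grng g]. *)
Lemma class_mx_summable : summable class_mx.
Proof.
apply: summable_of_finite => g.
pose s : seq link_class := pmap insub [seq rep k | k <- L (grng g)].
apply: (@sub_finite_set _ _ [set` s]); last exact: finite_seq.
move=> j [x xg x0] /=; rewrite mem_pmap_sub.
have [k [l kl]] : exists k l : class_member j, hs_val x k l <> 0.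
  apply: contrapT => h; apply: x0; apply: mx_eqP => k l; apply: contrapT => kl.
  by apply: h; exists k, l.
have [_ /(_ k l)[[s' [t [-> -> sg tg st]]]|//]] := xg.
rewrite class_deg_dom in sg; apply/mapP; exists (val k); first exact/memL.
by rewrite rep_member.
Qed.

Lemma class_member_nonempty j : [set: class_member j] !=set0.
Proof. by exists (exist _ (val j) (valP j)). Qed.

Lemma class_mx_iso : gr_iso R (gr_prod class_mx).
Proof.
apply: (gr_iso_of_components (f := to_prod)).
- exact: additive_graded_lift.
- move=> g h x y xg yh; apply: val_inj; apply: functional_extensionality_dep => j.
  exact: to_class_mxM xg yh.
- exact: to_prod_inj.
- exact: to_prod_surj.
Qed.

End Structure.

(** * The structure theorem *)

Theorem theorem5p30 (G : groupoid) (R : gring G) :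
  [<-> gr_semisimple R;

       exists (J : Type) (e : J -> gobj G) (D : J -> gring G) (K : J -> Type)
         (s : forall j, K j -> G)
         (hD : forall j, gr_division (D j))
         (suppD : forall j, supp (D j) `<=` ghom (e j) (e j))
         (rng_s : forall j k, grng (s j k) = e j)
         (fin_s : forall j, d_finite (s j)),
         let M j := mx_gring1 (hD j) (suppD j) (rng_s j) (fin_s j) in
         [/\ forall j, [set: K j] !=set0, summable M & gr_iso R (gr_prod M)];

       exists (J : Type) (D : J -> gring G) (K : J -> Type)
         (S : forall j, K j -> set G)
         (hS : forall j, matricial (D j) (S j)),
         let M j := mx_gring (hS j) in
         [/\ forall j, gr_division (D j) /\ gr_prime (D j),
             forall j, [set: K j] !=set0, summable M & gr_iso R (gr_prod M)];

       exists (J : Type) (Q : J -> gring G),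
         [/\ forall j, gr_simple (Q j) /\ obj_artinian (Q j), summable Q
           & gr_iso R (gr_prod Q)]].
Proof.
tfae.
- move=> /gr_semisimpleP /idem_system[K [ob [p [L [mp op uL memL one_sum]]]]].
  do 9! eexists; split; [exact: class_member_nonempty|
    exact: (class_mx_summable mp memL)|exact: (class_mx_iso mp op uL memL one_sum)].
- move=> [J [e [D [K [s [hD [suppD [rng_s [fin_s [K0 sM iM]]]]]]]]]].
  exists J, D, K, (fun j k => [set s j k]),
    (fun j => matricial_singleton (hD j) (suppD j) (rng_s j) (fin_s j)).
  by split=> // j; split=> //; exact: division_prime (hD j) (suppD j).
- move=> [J [D [K [S [hS [hD K0 sM iM]]]]]].
  exists J, (fun j => mx_gring (hS j)); split=> // j; have [dD pD] := hD j.
  by split; [exact: mx_gring_simple|exact: mx_gring_artinian].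
- by move=> [J [Q [hQ sQ iQ]]]; exact: semisimple_of_simple_artinian_factors sQ iQ.
Qed.
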